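(* Suppose that $f(z)=\sum_{k=0}^\infty a_k z^k$ is analytic in $\mathbb{D}$, $|f(z)|\le 1$ in $\mathbb{D}$, and $S_r$ denotes the area of the image of the subdisk $|z|<r$ under the mapping $f$. Then $$B_1(r):=\sum_{k=0}^\infty |a_k|r^k+\frac{16}{9}\left(\frac{S_r}{\pi}\right)\le 1\quad\text{for } r\le\frac13,$$ and the numbers $1/3$ and $16/9$ cannot be improved (neither can be replaced by a larger number, the other being kept, so that the inequality still holds for all such $f$). Moreover, $$B_2(r):=|a_0|^2+\sum_{k=1}^\infty |a_k|r^k+\frac{9}{8}\left(\frac{S_r}{\pi}\right)\le 1\quad\text{for } r\le\frac12,$$ and the constants $1/2$ and $9/8$ cannot be improved (in the same sense).
   Context: $\mathbb{D}=\{z\in\mathbb{C}:|z|<1\}$ is the open unit disk, and $0\le r<1$. The area $S_r$ is counted with multiplicity, i.e. $S_r=\iint_{|z|<r}|f'(z)|^2\,dx\,dy$, where $z=x+iy$. *)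

(* Defs.v *)
From mathcomp Require Import all_boot all_order all_algebra.
From mathcomp Require Import all_classical all_reals all_analysis.
From mathcomp Require Import complex.

Set Implicit Arguments.
Unset Strict Implicit.
Unset Printing Implicit Defensive.
Import Order.TTheory GRing.Theory Num.Theory.
Import numFieldNormedType.Exports.

Local Open Scope classical_set_scope.
Local Open Scope complex_scope.
Local Open Scope ring_scope.

(* The complex plane over the reals R is R[i]^o: the norm topology is attached
   to this alias of R[i].  The norm `|z| of R[i] is itself an element of R[i];
   cmod is the modulus as a real number. *)
Definition cmod (R : realType) (z : R[i]) : R := complex.Re `|z|.

(* f(z) = \sum_k a_k z^k at every point of the open unit disk; nothing is
   assumed of the values of f outside of it. *)
Definition power_series_on_disk (R : realType) (f : R[i]^o -> R[i]^o)
    (a : nat -> R[i]) : Prop :=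
  forall z : R[i], cmod z < 1 ->
    series (fun k => a k * z ^+ k : R[i]^o) @ \oo --> f z.

Definition bounded_by_one_on_disk (R : realType) (f : R[i]^o -> R[i]^o) : Prop :=
  forall z : R[i], cmod z < 1 -> cmod (f z) <= 1.

(* derive1 is taken over the field R[i], so it is the complex derivative. *)
Definition image_area (R : realType) (f : R[i]^o -> R[i]^o) (r : R) : \bar R :=
  (\int[(@lebesgue_measure R) \x (@lebesgue_measure R)]_(p in
      [set p : R * R | (cmod (p.1 +i* p.2) < r)%R])
    ((cmod (derive1 f (p.1 +i* p.2))) ^+ 2)%:E)%E.

(* The sums are series of nonnegative terms in \bar R, with value +oo in case
   of divergence. *)
Definition bohr_sum1 (R : realType) (c : R) (f : R[i]^o -> R[i]^o)
    (a : nat -> R[i]) (r : R) : \bar R :=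
  (\sum_(0 <= k <oo) (cmod (a k) * r ^+ k)%:E
   + c%:E * (image_area f r * (pi^-1)%:E))%E.

Definition bohr_sum2 (R : realType) (c : R) (f : R[i]^o -> R[i]^o)
    (a : nat -> R[i]) (r : R) : \bar R :=
  ((cmod (a 0) ^+ 2)%:E + \sum_(1 <= k <oo) (cmod (a k) * r ^+ k)%:E
   + c%:E * (image_area f r * (pi^-1)%:E))%E.

(* The inequality B <= 1 for all f in the class and all admissible radii up to
   rho, where B is bohr_sum1 c or bohr_sum2 c. *)
Definition bohr_inequality (R : realType)
    (B : (R[i]^o -> R[i]^o) -> (nat -> R[i]) -> R -> \bar R) (rho : R) : Prop :=
  forall (f : R[i]^o -> R[i]^o) (a : nat -> R[i]),
    power_series_on_disk f a -> bounded_by_one_on_disk f ->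
    forall r : R, 0 <= r < 1 -> r <= rho -> (B f a r <= 1)%E.

(* Main.v *)
Require Import Defs.
From mathcomp Require Import all_boot all_order all_algebra.
From mathcomp Require Import all_classical all_reals all_analysis.
From mathcomp Require Import measurable_realfun.
From mathcomp Require Import complex ring lra.
Import Order.TTheory GRing.Theory Num.Theory.
Import numFieldNormedType.Exports.
Set Implicit Arguments.
Unset Strict Implicit.
Unset Printing Implicit Defensive.
Local Open Scope classical_set_scope.
Local Open Scope complex_scope.
Local Open Scope ring_scope.

(** Write A for |a_0|^2.  Everything rests on how large the coefficients of a
    function bounded by one can be once a_0 is known, the extremal case being
    the disk automorphism (alpha - z) / (1 - alpha z), whose coefficients have
    moduli B_k = (1 - alpha^2) alpha^(k-1) for k >= 1.

    Coefficients.  Multiplication by f does not increase the mean square on a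
    circle, so testing it on 1 + kappa z^n bounds |a_0|^2 + ... +
    |a_(n-1)|^2 + |a_n + kappa a_0|^2 by 1 + |kappa|^2.  The best kappa turns
    this into the recursion s_n <= A s_(n-1) + (1 - A)^2 for
    s_n = |a_1|^2 + ... + |a_n|^2, hence (rogosinski) s_n is at most its value
    for the automorphism with alpha = |a_0|.  Summation by parts upgrades this
    to all nonnegative nonincreasing weights (weighted_coef_le).  No
    integration on circles is needed: the mean square of a polynomial over the
    n-th roots of unity is already given by Parseval's identity as soon as n
    exceeds the degree, and f is a uniform limit of polynomials on smaller
    disks.

    The inequalities.  The area is S_r = pi sum_(k >= 1) k |a_k|^2 r^(2k), and
    the weights k r^(2k) are nonincreasing for r^2 <= 1/2, so S_r is at most
    its value for the automorphism (area_sum_le).  If |a_0| >= r, the tangent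
    inequality |a_k| <= (|a_k|^2 / B_k + B_k) / 2, summed against r^k, bounds
    the Bohr sum by its value for the automorphism as well, because the weights
    r^k / B_k are then nonincreasing (bohr_sum_large_a0); if |a_0| < r, a cruder
    bound suffices.  All the sums increase with r, so that only r = 1/3 and
    r = 1/2 remain.  There the claim is a polynomial inequality in |a_0|: for
    the two automorphism bounds, one minus the left side has the factor
    (1 - |a_0|)^3.

    The area formula.  The derivative is the sum of the differentiated series
    (derive_power_series), and by dominated convergence one may integrate
    squared moduli of polynomials.  Averaging over the rotations by roots of
    unity removes the cross terms.  Rotations preserve plane Lebesgue measure
    since they are products of three shears, and a shear only translates the
    sections.  What is left are the integrals of |z|^(2k), computed from the
    area pi t of the disk |z|^2 <= t: pushing the plane measure forward along
    |z|^2 gives pi times Lebesgue measure on the half-line.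

    Sharpness.  For the automorphisms both sums are explicit (mobius_bohr).
    With alpha close to one they exceed 1 as soon as the radius or the constant
    is larger than claimed. *)

(** * The modulus and limits of complex sequences *)

Lemma cmodE (R : realType) (z : R[i]) : (cmod z)%:C = `|z|.
Proof. by rewrite /cmod normc_def. Qed.

Lemma cmod_ge0 (R : realType) (z : R[i]) : 0 <= cmod z.
Proof. by rewrite -ler0c cmodE normr_ge0. Qed.

Lemma cmodM (R : realType) (z w : R[i]) : cmod (z * w) = cmod z * cmod w.
Proof. by apply: (@complex.complexI R); rewrite rmorphM /= !cmodE normrM. Qed.

Lemma cmodX (R : realType) (z : R[i]) n : cmod (z ^+ n) = cmod z ^+ n.
Proof. by apply: (@complex.complexI R); rewrite rmorphXn /= !cmodE normrX. Qed.

Lemma cmodN (R : realType) (z : R[i]) : cmod (- z) = cmod z.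
Proof. by rewrite /cmod normrN. Qed.

Lemma cmodD (R : realType) (z w : R[i]) : cmod (z + w) <= cmod z + cmod w.
Proof. by rewrite -lecR rmorphD /= !cmodE ler_normD. Qed.

Lemma cmodB (R : realType) (z w : R[i]) : cmod (z - w) <= cmod z + cmod w.
Proof. by rewrite -(cmodN w) cmodD. Qed.

Lemma cmodV (R : realType) (z : R[i]) : cmod z^-1 = (cmod z)^-1.
Proof. by apply: (@complex.complexI R); rewrite fmorphV /= !cmodE normfV. Qed.

Lemma cmod0 (R : realType) : cmod (0 : R[i]) = 0.
Proof. by rewrite /cmod normr0. Qed.

Lemma cmod1 (R : realType) : cmod (1 : R[i]) = 1.
Proof. by rewrite /cmod normr1. Qed.

Lemma cmodR (R : realType) (x : R) : cmod x%:C = `|x|.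
Proof. by rewrite /cmod normc_def /= expr0n addr0 sqrtr_sqr. Qed.

Lemma cmod_sum (R : realType) (I : Type) (s : seq I) (P : pred I) (F : I -> R[i]) :
  cmod (\sum_(i <- s | P i) F i) <= \sum_(i <- s | P i) cmod (F i).
Proof.
elim/big_ind2: _ => [|x u y v xu yv|//]; first by rewrite cmod0.
exact: le_trans (cmodD _ _) (lerD _ _).
Qed.

Lemma cmod_nat (R : realType) n : cmod (n%:R : R[i]) = n%:R.
Proof.
by rewrite (_ : n%:R = (n%:R : R)%:C) ?cmodR ?normr_nat // rmorph_nat.
Qed.

Lemma sqr_cmod (R : realType) (z : R[i]) :
  cmod z ^+ 2 = complex.Re z ^+ 2 + complex.Im z ^+ 2.
Proof. by apply: (@complex.complexI R); rewrite add_Re2_Im2 -cmodE rmorphXn. Qed.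

(** Distances in R[i] are themselves elements of R[i]; through this criterion all
    estimates are carried out with real numbers. *)
Lemma cvg_cmodP (R : realType) (T : Type) (F : set_system T) (FF : Filter F)
    (f : T -> R[i]^o) (l : R[i]^o) :
  f @ F --> l <-> forall e : R, 0 < e -> \forall x \near F, cmod (f x - l) < e.
Proof.
split=> [/cvgrPdist_lt fl e e0|fl].
  have /fl : (0 : R[i]) < e%:C by rewrite ltcR.
  by apply: filterS => x; rewrite -cmodE ltcR -cmodN opprB.
apply/cvgrPdist_lt => -[e i]; rewrite ltcE /= => /andP[/eqP -> e0].
have /fl := e0; apply: filterS => x.
by rewrite -cmodE ltcR -cmodN opprB.
Qed.

Lemma cvg_cmod (R : realType) (T : Type) (F : set_system T) (FF : Filter F)
    (f : T -> R[i]^o) (l : R[i]^o) :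
  f @ F --> l -> cmod (f x) @[x --> F] --> cmod l.
Proof.
move=> /cvg_cmodP fl; apply/cvgrPdist_lt => e /fl; apply: filterS => x fx.
apply: le_lt_trans fx.
have := cmodD (l - f x) (f x); have := cmodD (f x - l) l.
rewrite !subrK -(cmodN (f x - l)) opprB => h1 h2.
rewrite ler_norml; apply/andP; split; lra.
Qed.

Lemma le_cmod_cvg (R : realType) (T : Type) (F : set_system T) (FF : ProperFilter F)
    (f : T -> R[i]^o) (l : R[i]^o) (c : R) :
  f @ F --> l -> (\forall x \near F, cmod (f x) <= c) -> cmod l <= c.
Proof.
move=> fl fc; rewrite -(cvg_lim (@Rhausdorff R) (cvg_cmod FF fl)).
by apply: limr_le fc; apply/cvg_ex; exists (cmod l); exact: cvg_cmod.
Qed.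

(** * Discrete Parseval identity and bounded multipliers *)

(** Primitive roots of arbitrarily large order are enough for the averages below,
    and iterated square roots of -1 provide them, of order a power of two. *)
Lemma prim_root_exists (F : numClosedFieldType) m :
  exists n, (m <= n)%N /\ exists w : F, n.-primitive_root w.
Proof.
exists (2 ^ m.+1)%N; split; first by rewrite ltnW// ltnW// ltn_expl.
have [w wm] : exists w : F, w ^+ (2 ^ m) = -1.
  elim: m => [|m [w wm]]; first by exists (-1); rewrite expr1.
  by exists (sqrtC w); rewrite expnS exprM sqrtCK.
have w1 : w ^+ (2 ^ m.+1) = 1 by rewrite expnSr exprM wm sqrrN expr1n.
have [|d wd dm] := prim_order_exists _ w1; first by rewrite expn_gt0.
exists w; suff -> : (2 ^ m.+1)%N = d by [].
have /dvdn_pfactor -/(_ isT)[j jm dE] := dm.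
move: jm; rewrite leq_eqVlt => /predU1P[jm|]; first by rewrite dE jm.
rewrite ltnS => jm; have : w ^+ (2 ^ m) == 1 by rewrite -(prim_order_dvd wd) dE dvdn_exp2l.
by rewrite wm eq_sym -addr_eq0 -mulr2n pnatr_eq0.
Qed.

Lemma norm_prim_root (F : numDomainType) n (w : F) :
  n.-primitive_root w -> `|w| = 1.
Proof.
move=> wn; apply/eqP; rewrite -(@pexpr_eq1 _ _ n) ?(prim_order_gt0 wn)//.
by rewrite -normrX (prim_expr_order wn) normr1.
Qed.

Lemma cmod_prim_root (R : realType) n (w : R[i]) :
  n.-primitive_root w -> cmod w = 1.
Proof. by move=> wn; apply: (@complex.complexI R); rewrite cmodE (norm_prim_root wn). Qed.

Lemma sum_prim_root (F : numClosedFieldType) n (w : F) (k l : 'I_n) :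
  n.-primitive_root w ->
  \sum_(j < n) (w ^+ j) ^+ k * ((w ^+ j) ^+ l)^* = (n * (k == l))%:R.
Proof.
move=> wn; have w1 := norm_prim_root wn.
have w0 : w != 0 by rewrite -normr_eq0 w1 oner_eq0.
have wJ m : (w ^+ m)^* = (w ^- m).
  by rewrite invC_norm normrX w1 !expr1n invr1 mul1r.
under eq_bigr => j _.
  rewrite -!exprM wJ mulnC [(_ * l)%N]mulnC !exprM -expr_div_n. over.
have [->|kl] := eqVneq k l.
  under eq_bigr do rewrite divff ?expf_neq0// expr1n.
  by rewrite sumr_const card_ord muln1.
rewrite muln0; set x := w ^+ k / w ^+ l.
have x1 : x - 1 != 0.
  rewrite subr_eq0 -(inj_eq (mulIf (expf_neq0 l w0))) divfK ?expf_neq0// mul1r.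
  by rewrite (eq_prim_root_expr wn) !modn_small.
apply: (mulfI x1); rewrite mulr0 -subrX1 /x expr_div_n -!exprM.
by rewrite mulnC [(l * _)%N]mulnC !exprM (prim_expr_order wn) !expr1n divr1 subrr.
Qed.

(** Exact rather than asymptotic: two distinct monomials of degree less than n are
    orthogonal for the n-th roots of unity. *)
Lemma parseval_prim_root (R : realType) m n (w : R[i]) (p : {poly R[i]}) (z : R[i]) :
  n.-primitive_root w -> (size p <= m)%N -> (m <= n)%N ->
  \sum_(j < n) cmod p.[w ^+ j * z] ^+ 2
  = n%:R * \sum_(k < m) cmod p`_k ^+ 2 * cmod z ^+ (2 * k).
Proof.
move=> wn pm mn; have sp := leq_trans pm mn.
rewrite (big_ord_widen _ (fun k => cmod p`_k ^+ 2 * cmod z ^+ (2 * k)) mn).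
have -> : \sum_(k < n | (k < m)%N) cmod p`_k ^+ 2 * cmod z ^+ (2 * k)
          = \sum_(k < n) cmod p`_k ^+ 2 * cmod z ^+ (2 * k).
  rewrite [RHS](bigID (fun k : 'I_n => (k < m)%N)) /= [X in _ + X]big1 ?addr0// => k.
  by rewrite -leqNgt => mk; rewrite nth_default ?(leq_trans pm)// cmod0 expr0n mul0r.
apply: (@complex.complexI R).
rewrite rmorphM rmorph_nat !rmorph_sum /=.
under eq_bigr do rewrite rmorphXn /= cmodE normCK (horner_coef_wide _ sp).
under [in RHS]eq_bigr do
  rewrite rmorphM !rmorphXn /= !cmodE exprM !normCK.
under eq_bigr => j _.
  rewrite rmorph_sum /= big_distrlr /=.
  under eq_bigr do under eq_bigr do
    rewrite !rmorphM /= !exprMn rmorphM /= mulrACA [X in _ * X]mulrACA mulrCA.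
  over.
rewrite exchange_big /= mulr_sumr; apply: eq_bigr => k _.
rewrite exchange_big /= (bigD1 k) //= [X in _ + X]big1; last first.
  by move=> l lk; rewrite -mulr_suml sum_prim_root// eq_sym (negPf lk) muln0 mul0r.
by rewrite addr0 -mulr_suml sum_prim_root// eqxx muln1 exprMn rmorphXn.
Qed.

(** Pointwise, |p e| <= K |e| on the circle; average this over roots of unity of
    order beyond both degrees, and keep only the first m coefficients of p e. *)
Lemma mul_poly_contraction (R : realType) (p e : {poly R[i]}) (rho K : R) m n :
  0 <= rho -> (size e <= n)%N ->
  (forall z, cmod z = rho -> cmod p.[z] <= K) ->
  \sum_(k < m) cmod (p * e)`_k ^+ 2 * rho ^+ (2 * k)
  <= K ^+ 2 * \sum_(k < n) cmod e`_k ^+ 2 * rho ^+ (2 * k).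
Proof.
move=> rho0 en pK; have rhoE : cmod rho%:C = rho by rewrite cmodR ger0_norm.
pose M := maxn (size (p * e)%R) (maxn m n).
have [N [MN [w wN]]] := prim_root_exists R[i] M.
have mM : (m <= M)%N by rewrite !leq_max leqnn orbT.
have nN : (n <= N)%N by rewrite (leq_trans _ MN)// !leq_max leqnn !orbT.
have pM : (size (p * e)%R <= M)%N by rewrite leq_max leqnn.
apply: (@le_trans _ _ (\sum_(k < M) cmod (p * e)`_k ^+ 2 * rho ^+ (2 * k))).
  rewrite (big_ord_widen _ (fun k => cmod (p * e)`_k ^+ 2 * rho ^+ (2 * k)) mM).
  rewrite [leRHS](bigID (fun k : 'I_M => (k < m)%N)) /= lerDl.
  by apply: sumr_ge0 => k _; rewrite mulr_ge0 ?sqr_ge0// exprn_ge0.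
have := parseval_prim_root rho%:C wN pM MN.
have := parseval_prim_root rho%:C wN en nN.
rewrite rhoE => eE peE.
rewrite -(@ler_pM2l _ N%:R) ?ltr0n ?(prim_order_gt0 wN)// -peE mulrCA -eE mulr_sumr.
apply: ler_sum => j _; rewrite hornerM cmodM exprMn ler_wpM2r ?sqr_ge0//.
rewrite lerXn2r ?nnegrE ?cmod_ge0//.
- by apply: le_trans (cmod_ge0 _) (pK rho%:C _).
- by apply: pK; rewrite cmodM cmodX rhoE (cmod_prim_root wN) expr1n mul1r.
Qed.

Lemma sum_geometric_le (R : realFieldType) (q : R) (M m : nat) :
  0 <= q < 1 -> \sum_(M <= k < m) q ^+ k <= q ^+ M / (1 - q).
Proof.
move=> /andP[q0 q1]; have q1' : 0 < 1 - q by rewrite subr_gt0.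
rewrite ler_pdivlMr//; have [Mm|mM] := leqP M m; last first.
  by rewrite big_geq 1?ltnW// mul0r exprn_ge0.
rewrite mulr_suml (eq_bigr (fun k => - (q ^+ k.+1 - q ^+ k))).
  by rewrite sumrN telescope_sumr// opprB gerBl exprn_ge0.
by move=> k _; rewrite exprS; ring.
Qed.

(** Cauchy's estimate without an integral: the terms of a convergent series are
    bounded. *)
Lemma power_series_coef_bound (R : realType) (f : R[i]^o -> R[i]^o) (a : nat -> R[i])
    (rho : R) : power_series_on_disk f a -> 0 <= rho < 1 ->
  exists2 C, 0 <= C & forall k, cmod (a k) * rho ^+ k <= C.
Proof.
move=> fa /andP[rho0 rho1].
have rhoE : cmod rho%:C = rho by rewrite cmodR ger0_norm.
have /fa cv : cmod rho%:C < 1 by rewrite rhoE.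
have : (fun k => a k * rho%:C ^+ k : R[i]^o) @ \oo --> (0 : R[i]^o).
  by apply: cvg_series_cvg_0; apply/cvg_ex; exists (f rho%:C).
move=> /cvg_cmodP /(_ 1 ltr01)[N _ NP].
have t0 k : 0 <= cmod (a k) * rho ^+ k by rewrite mulr_ge0 ?cmod_ge0// exprn_ge0.
exists (1 + \sum_(k < N) cmod (a k) * rho ^+ k) => [|k].
  by rewrite addr_ge0// sumr_ge0.
have [kN|Nk] := ltnP k N.
  rewrite (bigD1 (Ordinal kN)) //= addrCA lerDl addr_ge0// sumr_ge0//.
have := NP k Nk; rewrite /= subr0 cmodM cmodX rhoE => /ltW h.
by rewrite (le_trans h)// lerDl sumr_ge0.
Qed.

(** The coefficient bound on a slightly larger circle gives a geometric tail. *)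
Lemma power_series_uniform (R : realType) (f : R[i]^o -> R[i]^o) (a : nat -> R[i])
    (rho : R) : power_series_on_disk f a -> 0 <= rho < 1 ->
  forall eps, 0 < eps -> exists M0, forall M, (M0 <= M)%N -> forall z, cmod z <= rho ->
    cmod (f z - \sum_(k < M) a k * z ^+ k) <= eps.
Proof.
move=> fa /andP[rho0 rho1] eps eps0; pose s := (1 + rho) / 2.
have s1 : s < 1 by rewrite /s; lra.
have rs : rho < s by rewrite /s; lra.
have s0 : 0 < s by apply: le_lt_trans rs.
have [C C0 Ck] := power_series_coef_bound fa (introT andP (conj (ltW s0) s1)).
pose q := rho / s.
have q0 : 0 <= q by rewrite divr_ge0// ltW.
have q1 : q < 1 by rewrite ltr_pdivrMr// mul1r.
have q01 : 0 <= q < 1 by rewrite q0.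
have : (fun M => C / (1 - q) * q ^+ M) @ \oo --> (C / (1 - q) * 0).
  by apply: cvgMr; apply: cvg_expr; rewrite ger0_norm.
rewrite mulr0 => /cvgrPdist_le /(_ _ eps0)[M0 _ MP].
exists M0 => M /MP /=; rewrite sub0r normrN => Me z zr.
have z1 : cmod z < 1 by apply: le_lt_trans rho1.
apply: (@le_cmod_cvg _ _ \oo _
  (fun m => series (fun k => a k * z ^+ k : R[i]^o) m - \sum_(k < M) a k * z ^+ k)).
  by apply: cvgB; [exact: fa|exact: cvg_cst].
exists M => // m /= Mm; rewrite seriesEnat /= -(big_mkord xpredT (fun k => a k * z ^+ k)).
rewrite (big_cat_nat (n := M))//= addrAC subrr add0r.
apply: le_trans Me; rewrite ger0_norm; last first.
  by rewrite mulr_ge0 ?exprn_ge0// divr_ge0// subr_ge0 ltW.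
apply: le_trans (cmod_sum _ _ _) _.
apply: (@le_trans _ _ (\sum_(M <= k < m) C * q ^+ k)).
  apply: ler_sum => k _; rewrite cmodM cmodX.
  apply: (@le_trans _ _ (cmod (a k) * rho ^+ k)).
    by rewrite ler_wpM2l ?cmod_ge0// lerXn2r ?nnegrE ?cmod_ge0.
  have -> : rho = s * q by rewrite /q mulrC divfK ?gt_eqF.
  by rewrite exprMn mulrA ler_wpM2r// exprn_ge0.
rewrite -mulr_sumr -mulrA ler_wpM2l// mulrC.
exact: sum_geometric_le.
Qed.

(** * Coefficients of functions bounded by one *)

(** The contraction property of multiplication by f, tested on 1 + kappa z^n.
    For the truncations of f it holds with 1 + eps in place of 1, on the circle of
    radius 1 - eps; then eps tends to 0. *)
Lemma coef_binomial_test (R : realType) (f : R[i]^o -> R[i]^o) (a : nat -> R[i]) (kappa : R[i]) n :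
  power_series_on_disk f a -> bounded_by_one_on_disk f -> (0 < n)%N ->
  \sum_(k < n) cmod (a k) ^+ 2 + cmod (a n + kappa * a 0%N) ^+ 2 <= 1 + cmod kappa ^+ 2.
Proof.
move=> fa fb n0; set L := leLHS; set U := leRHS.
have main eps : 0 < eps -> eps < 1 -> (1 - eps) ^+ (2 * n) * L <= (1 + eps) ^+ 2 * U.
  (* One parameter for both limits, the radius and the accuracy of truncation. *)
  move=> eps0 eps1; pose rho := 1 - eps.
  have rho0 : 0 <= rho by rewrite subr_ge0 ltW.
  have rho1 : rho < 1 by rewrite /rho; lra.
  have [M0 HM] := power_series_uniform fa (introT andP (conj rho0 rho1)) eps0.
  pose M := maxn M0 n.+1; pose p := \poly_(k < M) a k.
  pose e : {poly R[i]} := 1 + kappa *: 'X^n.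
  have se : (size e <= n.+1)%N.
    rewrite (leq_trans (size_polyD _ _))// geq_max size_poly1 ltnS leq0n /=.
    by rewrite (leq_trans (size_scale_leq _ _))// size_polyXn.
  have pK z : cmod z = rho -> cmod p.[z] <= 1 + eps.
    move=> zr; have z1 : cmod z < 1 by rewrite zr.
    have := HM M (leq_maxl _ _) z; rewrite zr lexx => /(_ isT) h.
    rewrite horner_poly; set s := \sum_(_ < _) _ in h *.
    have -> : s = f z - (f z - s) by rewrite opprB addrC subrK.
    by rewrite (le_trans (cmodB _ _))// lerD// fb.
  have := mul_poly_contraction n.+1 rho0 se pK.
  have ek k : e`_k = (k == 0%N)%:R + kappa * (k == n)%:R.
    by rewrite coefD coef1 coefZ coefXn.
  have pek k : (k <= n)%N -> (p * e)`_k = a k + (k == n)%:R * (kappa * a 0%N).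
    move=> kn; have kM : (k < M)%N by rewrite leq_max ltnS kn orbT.
    rewrite mulrDr mulr1 -scalerAr coefD coefZ coefMXn !coef_poly kM.
    congr (_ + _); case: ltngtP kn => //= [_ _|-> _]; first by rewrite mulr0 mul0r.
    by rewrite subnn mul1r leq_max ltn0Sn orbT.
  rewrite !big_ord_recr /= => h.
  apply: le_trans (le_trans h _).
    rewrite mulrC mulrDl lerD//.
      rewrite mulr_suml; apply: ler_sum => k _; rewrite pek; last exact/ltnW.
      rewrite (ltn_eqF (ltn_ord k)) mul0r addr0 ler_wpM2l ?sqr_ge0//.
      by rewrite ler_wiXn2l ?rho0 ?ltW// leq_mul2l/= ltnW.
    by rewrite pek// eqxx mul1r.
  rewrite ler_wpM2l ?sqr_ge0// ek eqxx (gtn_eqF n0) add0r mulr1 lerD//; last first.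
    by rewrite ler_piMr ?sqr_ge0// exprn_ile1// ltW.
  rewrite (bigD1 (Ordinal n0)) //= big1 => [|k /eqP k0].
    by rewrite ek eqxx /= (ltn_eqF n0) mulr0 !addr0 cmod1 expr1n muln0 expr0 mulr1.
  have k0' : ((k : nat) == 0%N) = false by apply/eqP => h0; apply: k0; exact: val_inj.
  by rewrite ek k0' (ltn_eqF (ltn_ord k)) mulr0 addr0 cmod0 expr0n mul0r.
have cL : (1 - e) ^+ (2 * n) * L @[e --> 0^'+] --> (1 - 0) ^+ (2 * n) * L.
  apply: cvg_at_right_filter; apply: cvgMl; 
  apply: (@cvg_comp _ _ _ (fun e : R => 1 - e) (fun x => x ^+ _) _ (nbhs (1 - 0 : R))).
    by apply: cvgB; [exact: cvg_cst|exact: cvg_id].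
  exact: exprn_continuous.
have cU : (1 + e) ^+ 2 * U @[e --> 0^'+] --> (1 + 0) ^+ 2 * U.
  apply: cvg_at_right_filter; apply: cvgMl; 
  apply: (@cvg_comp _ _ _ (fun e : R => 1 + e) (fun x => x ^+ _) _ (nbhs (1 + 0 : R))).
    by apply: cvgD; [exact: cvg_cst|exact: cvg_id].
  exact: exprn_continuous.
rewrite subr0 expr1n mul1r in cL; rewrite addr0 expr1n mul1r in cU.
apply: (ler_cvg_to cL cU); near=> e; apply: main; near: e.
  exact: nbhs_right_gt.
by apply: nbhs_right_lt.
Unshelve. all: by end_near. Qed.

(** The case kappa = 0. *)
Lemma coef_sum_sqr_le1 (R : realType) (f : R[i]^o -> R[i]^o) (a : nat -> R[i]) n :
  power_series_on_disk f a -> bounded_by_one_on_disk f ->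
  cmod (a 0%N) ^+ 2 + \sum_(k < n) cmod (a k.+1) ^+ 2 <= 1.
Proof.
move=> fa fb; have := coef_binomial_test 0 fa fb (ltn0Sn n).
rewrite mul0r addr0 cmod0 expr0n /= addr0; apply: le_trans.
by rewrite big_ord_recl -addrA lerD2l lerDl sqr_ge0.
Qed.

(** With A = |a_0|^2, the choice kappa = conj(a_0) a_n / (1 - A) makes
    a_n + kappa a_0 = a_n / (1 - A), and the test inequality becomes
    |a_n|^2 <= (1 - A) (1 - A - s_(n-1)) for the partial sums s of
    |a_1|^2 + |a_2|^2 + ...  The right-hand side of the lemma solves the
    resulting recursion s_n <= A s_(n-1) + (1 - A)^2 with equality. *)
Lemma rogosinski (R : realType) (f : R[i]^o -> R[i]^o) (a : nat -> R[i]) n :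
  power_series_on_disk f a -> bounded_by_one_on_disk f ->
  \sum_(k < n) cmod (a k.+1) ^+ 2
  <= \sum_(k < n) ((1 - cmod (a 0%N) ^+ 2) * cmod (a 0%N) ^+ k) ^+ 2.
Proof.
move=> fa fb; set A := cmod (a 0%N) ^+ 2.
under [leRHS]eq_bigr do rewrite exprMn -exprM mulnC exprM -/A.
have A0 : 0 <= A by exact: sqr_ge0.
have parseval m := coef_sum_sqr_le1 m fa fb.
have A1 : A <= 1 by have := parseval 0%N; rewrite big_ord0 addr0 -/A.
elim: n => [|n IH]; first by rewrite !big_ord0.
rewrite [leRHS]big_ord_recl expr0 mulr1.
under [X in _ <= _ + X]eq_bigr do rewrite lift0 [A ^+ _.+1]exprS mulrCA.
rewrite -mulr_sumr big_ord_recr /=.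
set s := \sum_(_ < _) _ in IH *; set t := \sum_(_ < _) _ in IH *.
set x := cmod (a n.+1) ^+ 2.
suff : s + x <= (1 - A) ^+ 2 + A * s.
  by move=> h; apply: le_trans h _; rewrite lerD2l ler_wpM2l.
have x0 : 0 <= x by exact: sqr_ge0.
have s0 : 0 <= s by apply: sumr_ge0 => k _; exact: sqr_ge0.
(* kappa is undefined for A = 1, but then all other coefficients vanish. *)
move: A1; rewrite le_eqVlt => /predU1P[A1|A1].
  by have := parseval n.+1; rewrite -/A big_ord_recr /= -/s -/x A1; lra.
have A1' : 0 < 1 - A by rewrite subr_gt0.
pose c := (1 - A)%:C.
have c0 : c != 0 by rewrite eq_complex /= eqxx andbT gt_eqF.
pose kappa := (a 0%N)^* * a n.+1 / c.
have := coef_binomial_test kappa fa fb (ltn0Sn n).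
have -> : a n.+1 + kappa * a 0%N = a n.+1 / c.
  have -> : kappa * a 0%N = a n.+1 / c * (a 0%N * (a 0%N)^*) by rewrite /kappa; ring.
  rewrite -normCK -cmodE -rmorphXn /= -/A -{1}[a n.+1](divfK c0) -mulrDr.
  by rewrite -rmorphD /= subrK mulr1.
have -> : cmod kappa ^+ 2 = A * x / (1 - A) ^+ 2.
  have -> : cmod kappa = cmod (a 0%N) * cmod (a n.+1) / (1 - A).
    rewrite !cmodM cmodV cmodR (ger0_norm (ltW A1')); congr (_ * _ / _).
    by apply: (@complex.complexI R); rewrite !cmodE norm_conjC.
  by rewrite !exprMn exprVn.
have -> : cmod (a n.+1 / c) ^+ 2 = x / (1 - A) ^+ 2.
  by rewrite cmodM cmodV cmodR exprMn exprVn real_normK// num_real.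
rewrite big_ord_recl /= -/A -/s => h.
have {}h : A + s + x / (1 - A) <= 1.
  have -> : x / (1 - A) = x / (1 - A) ^+ 2 - A * x / (1 - A) ^+ 2.
    by field; rewrite gt_eqF.
  by rewrite addrA lerBlDr.
have -> : x = x / (1 - A) * (1 - A) by rewrite divfK ?gt_eqF.
move: (x / (1 - A)) h => y h.
have : y * (1 - A) <= (1 - A - s) * (1 - A) by rewrite ler_wpM2r ?(ltW A1')//; lra.
by move=> h'; apply: le_trans (lerD (lexx s) h') _; lra.
Qed.

(** * Weighted sums and the two inequalities for partial sums *)

(** Summation by parts, arranged as an induction: the difference of the two sides
    is at least l n times the nonnegative partial sum of y - x. *)
Lemma abel_sum_le (R : realDomainType) (l x y : nat -> R) n :
  (forall k, 0 <= l k) -> (forall k, l k.+1 <= l k) ->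
  (forall m, \sum_(k < m) x k <= \sum_(k < m) y k) ->
  \sum_(k < n) l k * x k <= \sum_(k < n) l k * y k.
Proof.
move=> l0 l1 xy; rewrite -subr_ge0.
have D0 m : 0 <= \sum_(k < m) y k - \sum_(k < m) x k by rewrite subr_ge0.
suff : l n * (\sum_(k < n) y k - \sum_(k < n) x k)
       <= \sum_(k < n) l k * y k - \sum_(k < n) l k * x k.
  by apply: le_trans; rewrite mulr_ge0.
elim: n => [|n IH]; first by rewrite !big_ord0 subrr mulr0.
apply: (@le_trans _ _ (l n * (\sum_(k < n.+1) y k - \sum_(k < n.+1) x k))).
  by rewrite ler_wpM2r.
rewrite !big_ord_recr /=; lra.
Qed.

Lemma weighted_coef_le (R : realType) (f : R[i]^o -> R[i]^o) (a : nat -> R[i])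
    (l : nat -> R) n :
  power_series_on_disk f a -> bounded_by_one_on_disk f ->
  (forall k, 0 <= l k) -> (forall k, l k.+1 <= l k) ->
  \sum_(k < n) l k * cmod (a k.+1) ^+ 2
  <= \sum_(k < n) l k * ((1 - cmod (a 0%N) ^+ 2) * cmod (a 0%N) ^+ k) ^+ 2.
Proof.
move=> fa fb l0 l1.
apply: (abel_sum_le (x := fun k => cmod (a k.+1) ^+ 2)
  (y := fun k => ((1 - cmod (a 0%N) ^+ 2) * cmod (a 0%N) ^+ k) ^+ 2)) => // m.
exact: (rogosinski m fa fb).
Qed.

Lemma cmod_coef_le1 (R : realType) (f : R[i]^o -> R[i]^o) (a : nat -> R[i]) n :
  power_series_on_disk f a -> bounded_by_one_on_disk f -> cmod (a n) <= 1.
Proof.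
move=> fa fb; rewrite -(@expr_le1 _ 2) ?cmod_ge0//.
apply: le_trans (coef_sum_sqr_le1 n fa fb).
case: n => [|n]; first by rewrite big_ord0 addr0.
by rewrite big_ord_recr /= addrA lerDr addr_ge0 ?sqr_ge0// sumr_ge0// => k _; rewrite sqr_ge0.
Qed.

Lemma sum_geo_deriv (R : realFieldType) (q : R) n : q != 1 ->
  \sum_(k < n) k.+1%:R * q ^+ k
  = (1 - n.+1%:R * q ^+ n + n%:R * q ^+ n.+1) / (1 - q) ^+ 2.
Proof.
move=> q1; have q1' : 1 - q != 0 by rewrite subr_eq0 eq_sym.
elim: n => [|n IH]; first by rewrite big_ord0 expr0 mulr1 subrr mul0r addr0 mul0r.
by rewrite big_ord_recr /= IH !exprS -!natr1; field.
Qed.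

Lemma sum_geo_deriv_le (R : realFieldType) (q : R) n : 0 <= q < 1 ->
  \sum_(k < n) k.+1%:R * q ^+ k <= (1 - q) ^- 2.
Proof.
move=> /andP[q0 q1]; rewrite sum_geo_deriv ?lt_eqF//.
rewrite ler_pdivrMr ?exprn_gt0 ?subr_gt0// mulVf ?expf_neq0 ?gt_eqF ?subr_gt0//.
rewrite -subr_ge0 (_ : _ - _ = q ^+ n * (1 + n%:R * (1 - q))).
  by rewrite mulr_ge0 ?exprn_ge0// addr_ge0// mulr_ge0// subr_ge0 ltW.
by rewrite exprS -natr1; ring.
Qed.

Lemma sum_geo_le (R : realFieldType) (q : R) n : 0 <= q < 1 ->
  \sum_(k < n) q ^+ k <= (1 - q)^-1.
Proof.
by move=> q01; rewrite -(big_mkord xpredT (fun k => q ^+ k))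
  (le_trans (sum_geometric_le 0 n q01))// expr0 mul1r.
Qed.

(** The hypothesis on r is what makes the weights k r^(2k) nonincreasing; it is
    tight at k = 1, where the comparison reads 2 r^4 <= r^2. *)
Lemma area_sum_le (R : realType) (f : R[i]^o -> R[i]^o) (a : nat -> R[i]) (r : R) n :
  power_series_on_disk f a -> bounded_by_one_on_disk f ->
  0 <= r -> r ^+ 2 <= 1 / 2 ->
  \sum_(k < n) k.+1%:R * cmod (a k.+1) ^+ 2 * r ^+ (2 * k.+1)
  <= r ^+ 2 * (1 - cmod (a 0%N) ^+ 2) ^+ 2 / (1 - cmod (a 0%N) ^+ 2 * r ^+ 2) ^+ 2.
Proof.
move=> fa fb r0 r2; set A := cmod (a 0%N) ^+ 2.
have A0 : 0 <= A by exact: sqr_ge0.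
have A1 : A <= 1 by rewrite expr_le1 ?cmod_ge0// (cmod_coef_le1 _ fa fb).
have s0 : 0 <= r ^+ 2 by exact: sqr_ge0.
rewrite (eq_bigr (fun k : 'I_n =>
    r ^+ 2 * ((k.+1%:R * (r ^+ 2) ^+ k) * cmod (a k.+1) ^+ 2))); last first.
  by move=> k _; rewrite exprM [_ ^+ k.+1]exprS; ring.
rewrite -mulr_sumr -mulrA ler_wpM2l//.
have l1 k : k.+2%:R * (r ^+ 2) ^+ k.+1 <= k.+1%:R * (r ^+ 2) ^+ k.
  rewrite exprS mulrA ler_wpM2r ?exprn_ge0//.
  have k0 : 0 <= k%:R :> R by [].
  by rewrite -!natr1; nra.
apply: le_trans (weighted_coef_le n fa fb _ l1) _.
  by move=> k; rewrite mulr_ge0// exprn_ge0.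
rewrite (eq_bigr (fun k : 'I_n =>
    (1 - A) ^+ 2 * (k.+1%:R * (A * r ^+ 2) ^+ k))); last first.
  by move=> k _; rewrite [(_ * _ ^+ k) ^+ 2]exprMn [(A * _) ^+ k]exprMn [(cmod _ ^+ k) ^+ 2]exprAC -/A; ring.
rewrite -mulr_sumr ler_wpM2l ?sqr_ge0// sum_geo_deriv_le//.
by rewrite mulr_ge0//=; nra.
Qed.

(** With B_k the coefficients of the extremal automorphism, the tangent
    inequality |a_k| <= (|a_k|^2 / B_k + B_k) / 2 leaves a square sum with
    weights r^k / B_k, proportional to (r / |a_0|)^k: this is where r <= |a_0|
    enters. *)
Lemma bohr_sum_large_a0 (R : realType) (f : R[i]^o -> R[i]^o) (a : nat -> R[i]) (r : R) n :
  power_series_on_disk f a -> bounded_by_one_on_disk f ->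
  0 < r < 1 -> r <= cmod (a 0%N) ->
  \sum_(k < n) cmod (a k.+1) * r ^+ k.+1
  <= (1 - cmod (a 0%N) ^+ 2) * r / (1 - cmod (a 0%N) * r).
Proof.
move=> fa fb /andP[r0 r1] ra; set c := cmod (a 0%N) in ra *.
have c1 : c <= 1 := cmod_coef_le1 0 fa fb.
have c0 : 0 < c by apply: lt_le_trans ra.
have c20 : 0 <= 1 - c ^+ 2 by rewrite subr_ge0 expr_le1// ltW.
have cr1 : c * r < 1 by nra.
rewrite (eq_bigr (fun k : 'I_n => r * (cmod (a k.+1) * r ^+ k))); last first.
  by move=> k _; rewrite exprS; ring.
rewrite -mulr_sumr [(1 - _) * r]mulrC -[leRHS]mulrA ler_wpM2l ?(ltW r0)//.
suff h : \sum_(k < n) cmod (a k.+1) * r ^+ k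
         <= \sum_(k < n) (1 - c ^+ 2) * (c * r) ^+ k.
  apply: (le_trans h); rewrite -mulr_sumr ler_wpM2l// sum_geo_le// cr1 andbT.
  by rewrite mulr_ge0// ltW.
(* The weights divide by 1 - c^2; for c = 1 the coefficients vanish. *)
have [c2|c2] := eqVneq (1 - c ^+ 2) 0.
  have h0 k : cmod (a k.+1) = 0.
    have := rogosinski k.+1 fa fb; rewrite -/c c2.
    under [leRHS]eq_bigr do rewrite mul0r expr0n.
    rewrite [leRHS]big1// big_ord_recr /= => h.
    apply/eqP; rewrite -sqrf_eq0 eq_le sqr_ge0 andbT; apply: le_trans h.
    by rewrite lerDr sumr_ge0// => ? _; rewrite sqr_ge0.
  by rewrite c2; under eq_bigr do rewrite h0 mul0r; under [leRHS]eq_bigr do rewrite mul0r.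
have c2p : 0 < 1 - c ^+ 2 by rewrite lt_neqAle eq_sym c2.
pose l k := (r / c) ^+ k / (1 - c ^+ 2).
have rc0 : 0 <= r / c by rewrite divr_ge0// ltW.
have rc1 : r / c <= 1 by rewrite ler_pdivrMr// mul1r.
have l0 k : 0 <= l k by rewrite divr_ge0// exprn_ge0.
have l1 k : l k.+1 <= l k.
  by rewrite ler_wpM2r ?invr_ge0// exprS ler_piMl// exprn_ge0.
have h := weighted_coef_le n fa fb l0 l1; rewrite -/c in h.
have e k : l k * ((1 - c ^+ 2) * c ^+ k) ^+ 2 = (1 - c ^+ 2) * (c * r) ^+ k.
  rewrite /l expr_div_n [(c * r) ^+ k]exprMn; field.
  by rewrite c2 expf_neq0// gt_eqF.
rewrite -(ler_pM2l (ltr0n R 2 : 0 < 2)) mulr_sumr [leRHS]mulr_natl mulr2n.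
apply: (@le_trans _ _ (\sum_(k < n) (l k * cmod (a k.+1) ^+ 2 + (1 - c ^+ 2) * (c * r) ^+ k))).
  apply: ler_sum => k _; rewrite -e.
  have -> : r ^+ k = l k * ((1 - c ^+ 2) * c ^+ k).
    rewrite /l expr_div_n; field.
    by rewrite c2 expf_neq0// gt_eqF.
  move: (l0 k); set lk := l k; set b := _ * c ^+ k; set x := cmod _ => l0k.
  rewrite -subr_ge0 (_ : _ - _ = lk * (x - b) ^+ 2); last by ring.
  by rewrite mulr_ge0 ?sqr_ge0.
rewrite big_split /= lerD2r; apply: (le_trans h).
by apply: ler_sum => k _; rewrite -e.
Qed.

(** For |a_0| < r the previous weights grow.  Comparing |a_k| with t r^k instead
    gives constant weights; t is free and is fixed later to suit each radius. *)
Lemma bohr_sum_small_a0 (R : realType) (f : R[i]^o -> R[i]^o) (a : nat -> R[i]) (r t : R) n :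
  power_series_on_disk f a -> bounded_by_one_on_disk f ->
  0 <= r < 1 -> 0 < t ->
  \sum_(k < n) cmod (a k.+1) * r ^+ k.+1
  <= (1 - cmod (a 0%N) ^+ 2) / (2 * t) + t * r ^+ 2 / (2 * (1 - r ^+ 2)).
Proof.
move=> fa fb /andP[r0 r1] t0.
have r2 : 0 <= r ^+ 2 < 1 by rewrite sqr_ge0/= expr_lt1.
apply: (@le_trans _ _ (\sum_(k < n) (cmod (a k.+1) ^+ 2 / (2 * t)
                                     + t * r ^+ 2 / 2 * (r ^+ 2) ^+ k))).
  apply: ler_sum => k _; set x := cmod _.
  rewrite -exprM -subr_ge0.
  rewrite (_ : _ - _ = (x - t * r ^+ k.+1) ^+ 2 / (2 * t)).
    by rewrite divr_ge0 ?sqr_ge0// mulr_ge0// ltW.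
  by rewrite mulnC exprM !exprS; field; rewrite gt_eqF.
rewrite big_split /= -mulr_suml -mulr_sumr lerD//.
  rewrite ler_wpM2r ?invr_ge0 ?mulr_ge0 ?(ltW t0)//.
  by rewrite lerBrDl; exact: (coef_sum_sqr_le1 n fa fb).
rewrite invfM [leRHS]mulrA ler_wpM2l//.
  by rewrite !mulr_ge0 ?sqr_ge0// ltW.
exact: sum_geo_le.
Qed.

Lemma area_sum_homo (R : realType) (a : nat -> R[i]) (r s : R) n :
  0 <= r <= s ->
  \sum_(k < n) k.+1%:R * cmod (a k.+1) ^+ 2 * r ^+ (2 * k.+1)
  <= \sum_(k < n) k.+1%:R * cmod (a k.+1) ^+ 2 * s ^+ (2 * k.+1).
Proof.
move=> /andP[r0 rs]; apply: ler_sum => k _.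
apply: ler_wpM2l; first by rewrite mulr_ge0 ?sqr_ge0.
by apply: lerXn2r => //; rewrite nnegrE// (le_trans r0).
Qed.

Lemma coef_sum_homo (R : realType) (a : nat -> R[i]) (r s : R) n :
  0 <= r <= s ->
  \sum_(k < n) cmod (a k.+1) * r ^+ k.+1 <= \sum_(k < n) cmod (a k.+1) * s ^+ k.+1.
Proof.
move=> /andP[r0 rs]; apply: ler_sum => k _.
apply: ler_wpM2l; first exact: cmod_ge0.
by apply: lerXn2r => //; rewrite nnegrE// (le_trans r0).
Qed.

(** The bounds at r = 1/3 that hold whenever |a_0| >= 1/3 add up to at most 1
    exactly when 0 <= (1 - c)^3 (19 + 12 c + c^2) for c = |a_0|, so there is no
    room near c = 1, while for c < 1/3 the cruder bound is far from critical. *)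
Lemma bohr_partial_sums1_le1 (R : realType) (f : R[i]^o -> R[i]^o) (a : nat -> R[i]) (r : R) m n :
  power_series_on_disk f a -> bounded_by_one_on_disk f -> 0 <= r -> r <= 1 / 3 ->
  cmod (a 0%N) + \sum_(k < m) cmod (a k.+1) * r ^+ k.+1
  + 16 / 9 * \sum_(k < n) k.+1%:R * cmod (a k.+1) ^+ 2 * r ^+ (2 * k.+1) <= 1.
Proof.
move=> fa fb r0 r3.
have r03 : 0 <= r <= 1 / 3 by rewrite r0.
have h0 : 0 <= 1 / 3 :> R by lra.
have := coef_sum_homo a m r03; have := area_sum_homo a n r03.
have c1 := cmod_coef_le1 0 fa fb; have c0 := cmod_ge0 (a 0%N).
have := @area_sum_le _ _ _ (1 / 3) n fa fb h0 ltac:(lra).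
(* 8/3 is a rational value near sqrt 8, the best t for a_0 = 0. *)
have := @bohr_sum_small_a0 _ _ _ (1 / 3) (8 / 3) m fa fb ltac:(lra) ltac:(lra).
have := @bohr_sum_large_a0 _ _ _ (1 / 3) m fa fb ltac:(lra).
move: (\sum_(k < m) _ * r ^+ _) (\sum_(k < n) _ * r ^+ _) => S1 S2.
move: (\sum_(k < m) _ * (1 / 3) ^+ _) (\sum_(k < n) _ * (1 / 3) ^+ _) => T1 T2.
set c := cmod _ in c0 c1 * => large small area S2T2 S1T1.
have d9 : 9 - c ^+ 2 != 0 by rewrite gt_eqF//; nra.
have d3 : 3 - c != 0 by rewrite gt_eqF//; lra.
have {}area : 16 / 9 * T2 <= 16 * ((1 - c ^+ 2) / (9 - c ^+ 2)) ^+ 2.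
  apply: le_trans (ler_wpM2l _ area) _; first by lra.
  rewrite le_eqVlt; apply/orP; left; apply/eqP; field.
  by rewrite d9.
have [c3|c3] := leP (1 / 3) c.
  have {large}/large : 1 / 3 <= c by []; rewrite (_ : _ / (1 - _) = (1 - c ^+ 2) / (3 - c)); last first.
    by field; rewrite d3 .
  move=> large.
  have key : c + (1 - c ^+ 2) / (3 - c) + 16 * ((1 - c ^+ 2) / (9 - c ^+ 2)) ^+ 2 <= 1.
    rewrite -subr_ge0.
    rewrite (_ : _ - _ = 2 * (1 - c) ^+ 3 * (19 + 12 * c + c ^+ 2) / (9 - c ^+ 2) ^+ 2).
      by rewrite divr_ge0 ?sqr_ge0// !mulr_ge0 ?exprn_ge0//; nra.
    by field; rewrite d3 d9.
  lra.
have q : (1 - c ^+ 2) / (9 - c ^+ 2) <= 1 / 9.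
  by rewrite ler_pdivrMr; nra.
have q0 : 0 <= (1 - c ^+ 2) / (9 - c ^+ 2) by rewrite divr_ge0//; nra.
move: (_ / (9 - _)) q q0 area => q q1 q0 area.
have : 16 * q ^+ 2 <= 16 / 81 by nra.
have : (1 - c ^+ 2) / (2 * (8 / 3)) <= 3 / 16 by nra.
have : 8 / 3 * (1 / 3) ^+ 2 / (2 * (1 - (1 / 3) ^+ 2)) = 1 / 6 :> R by field.
lra.
Qed.

(** As for the first inequality; here the remainder is a positive multiple of
    (1 - c)^3 (1 + c) (7/2 + 3 c + c^2). *)
Lemma bohr_partial_sums2_le1 (R : realType) (f : R[i]^o -> R[i]^o) (a : nat -> R[i]) (r : R) m n :
  power_series_on_disk f a -> bounded_by_one_on_disk f -> 0 <= r -> r <= 1 / 2 ->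
  cmod (a 0%N) ^+ 2 + \sum_(k < m) cmod (a k.+1) * r ^+ k.+1
  + 9 / 8 * \sum_(k < n) k.+1%:R * cmod (a k.+1) ^+ 2 * r ^+ (2 * k.+1) <= 1.
Proof.
move=> fa fb r0 r3.
have r03 : 0 <= r <= 1 / 2 by rewrite r0.
have h0 : 0 <= 1 / 2 :> R by lra.
have := coef_sum_homo a m r03; have := area_sum_homo a n r03.
have c1 := cmod_coef_le1 0 fa fb; have c0 := cmod_ge0 (a 0%N).
have := @area_sum_le _ _ _ (1 / 2) n fa fb h0 ltac:(lra).
(* 7/4 is a rational value near sqrt 3, the best t for a_0 = 0. *)
have := @bohr_sum_small_a0 _ _ _ (1 / 2) (7 / 4) m fa fb ltac:(lra) ltac:(lra).
have := @bohr_sum_large_a0 _ _ _ (1 / 2) m fa fb ltac:(lra).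
move: (\sum_(k < m) _ * r ^+ _) (\sum_(k < n) _ * r ^+ _) => S1 S2.
move: (\sum_(k < m) _ * (1 / 2) ^+ _) (\sum_(k < n) _ * (1 / 2) ^+ _) => T1 T2.
set c := cmod _ in c0 c1 * => large small area S2T2 S1T1.
have d4 : 4 - c ^+ 2 != 0 by rewrite gt_eqF//; nra.
have d2 : 2 - c != 0 by rewrite gt_eqF//; lra.
have {}area : 9 / 8 * T2 <= 9 / 2 * ((1 - c ^+ 2) / (4 - c ^+ 2)) ^+ 2.
  apply: le_trans (ler_wpM2l _ area) _; first by lra.
  rewrite le_eqVlt; apply/orP; left; apply/eqP; field.
  by rewrite d4.
have [c3|c3] := leP (1 / 2) c.
  have {large}/large : 1 / 2 <= c by []; rewrite (_ : _ / (1 - _) = (1 - c ^+ 2) / (2 - c)); last first.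
    by field; rewrite d2.
  move=> large.
  have key : c ^+ 2 + (1 - c ^+ 2) / (2 - c) + 9 / 2 * ((1 - c ^+ 2) / (4 - c ^+ 2)) ^+ 2 <= 1.
    rewrite -subr_ge0.
    rewrite (_ : _ - _ = (1 - c) ^+ 3 * (1 + c) * (7 / 2 + 3 * c + c ^+ 2) / (4 - c ^+ 2) ^+ 2).
      by rewrite divr_ge0 ?sqr_ge0// !mulr_ge0 ?exprn_ge0//; nra.
    by field; rewrite d2 d4.
  lra.
have [u0 u1] : 0 <= c ^+ 2 /\ c ^+ 2 <= 1 / 4 by split; nra.
move: (c ^+ 2) u0 u1 small area d4 => u u0 u1 small area d4.
(* Concavity in u: the graph lies below its tangent at u = 0. *)
have q : (1 - u) / (4 - u) <= (1 - 3 / 4 * u) / 4.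
  by rewrite ler_pdivrMr; nra.
have q0 : 0 <= (1 - u) / (4 - u) by rewrite divr_ge0//; nra.
move: (_ / (4 - _)) q q0 area => q q1 q0 area.
have : q ^+ 2 <= ((1 - 3 / 4 * u) / 4) ^+ 2 by rewrite lerXn2r ?nnegrE//; lra.
have : 7 / 4 * (1 / 2) ^+ 2 / (2 * (1 - (1 / 2) ^+ 2)) = 7 / 24 :> R by field.
have : (1 - u) / (2 * (7 / 4)) = (1 - u) * (2 / 7) by field.
nra.
Qed.

(** * Rotation invariance of plane Lebesgue measure *)

Notation lebesgue2 R := ((@lebesgue_measure R) \x (@lebesgue_measure R))%E.

(** Lebesgue measure is determined by the lengths of half-open intervals. *)
Lemma lebesgue_measure_translation (R : realType) (c : R) (A : set R) :
  measurable A ->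
  pushforward (@lebesgue_measure R) (+%R c : _ -> measurableTypeR R) A
  = lebesgue_measure A.
Proof.
move=> mA; apply/esym/lebesgue_measure_unique => //=; first exact: measurable_funD.
move=> mc _ [[a b]] _ <-.
rewrite /pushforward /=.
have -> : +%R c @^-1` [set` `]a, b]] = [set` `](a - c), (b - c)]].
  by apply/seteqP; split=> x /=; rewrite !in_itv/= ltrBlDl lerBrDl.
rewrite !lebesgue_measure_itv/= !lte_fin ltrD2r.
by rewrite -!EFinB opprB addrA subrK.
Qed.

Lemma integral_translation (R : realType) (c : R) (h : R -> \bar R) :
  measurable_fun setT h -> (forall x, 0 <= h x)%E ->
  (\int[@lebesgue_measure R]_y h (c + y)%R = \int[@lebesgue_measure R]_y h y)%E.
Proof.
move=> mh h0.
have mc : measurable_fun setT (+%R c : measurableTypeR R -> measurableTypeR R).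
  exact: measurable_funD.
have := @ge0_integral_pushforward _ _ _ _ _ _ mc (@lebesgue_measure R) setT h measurableT mh.
rewrite preimage_setT => <-; last by move=> x _.
by apply: eq_measure_integral => A mA _; exact: lebesgue_measure_translation.
Qed.

(** The plane measure and a function on R * R carry different, though convertible,
    product sigma-algebra structures; this form mixes them as the integrals below
    do, so that it can be used for rewriting. *)
Lemma tonelli1 (R : realType) (h : R * R -> \bar R) :
  measurable_fun setT h -> (forall x, 0 <= h x)%E ->
  (\int[lebesgue2 R]_p h p
   = \int[@lebesgue_measure R]_x \int[@lebesgue_measure R]_y h (x, y))%E.
Proof.
move=> mh h0.
refine (@fubini_tonelli1 _ _ _ _ _ (@lebesgue_measure R) (@lebesgue_measure R) h mh h0).
Qed.

Lemma tonelli2 (R : realType) (h : R * R -> \bar R) :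
  measurable_fun setT h -> (forall x, 0 <= h x)%E ->
  (\int[lebesgue2 R]_p h p
   = \int[@lebesgue_measure R]_y \int[@lebesgue_measure R]_x h (x, y))%E.
Proof.
move=> mh h0.
refine (@fubini_tonelli2 _ _ _ _ _ (@lebesgue_measure R) (@lebesgue_measure R) h mh h0).
Qed.

(** By Tonelli: on each vertical line a shear is a translation. *)
Lemma integral_shear2 (R : realType) (t : R) (h : R * R -> \bar R) :
  measurable_fun setT h -> (forall x, 0 <= h x)%E ->
  (\int[lebesgue2 R]_p h (p.1, (t * p.1 + p.2)%R) = \int[lebesgue2 R]_p h p)%E.
Proof.
move=> mh h0.
rewrite (tonelli1 mh)// tonelli1//; last first.
  apply: measurableT_comp => //.
  apply/measurable_fun_pairP; split; first exact: measurable_fst.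
  by apply: measurable_funD; [exact: measurable_funM|exact: measurable_snd].
apply: eq_integral => x _; rewrite /=.
apply: (@integral_translation R _ (fun y => h (x, y))) => //.
exact: measurableT_comp.
Qed.

Lemma integral_shear1 (R : realType) (t : R) (h : R * R -> \bar R) :
  measurable_fun setT h -> (forall x, 0 <= h x)%E ->
  (\int[lebesgue2 R]_p h ((t * p.2 + p.1)%R, p.2) = \int[lebesgue2 R]_p h p)%E.
Proof.
move=> mh h0.
rewrite (tonelli2 mh)// tonelli2//; last first.
  apply: measurableT_comp => //.
  apply/measurable_fun_pairP; split; last exact: measurable_snd.
  by apply: measurable_funD; [exact: measurable_funM|exact: measurable_fst].
apply: eq_integral => y _; rewrite /=.
apply: (@integral_translation R _ (fun x => h (x, y))) => //.
exact: measurableT_comp.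
Qed.

Lemma measurable_linear2 (R : realType) (a b : R) :
  measurable_fun setT (fun p : R * R => a * p.1 + b * p.2).
Proof.
by apply: measurable_funD; apply: measurable_funM.
Qed.

(** With t = s / (1 + c), the tangent of half the angle, the rotation is the
    product of the shears of parameters -t, s and -t.  The half-turn, for which
    t is undefined, is the square of a quarter-turn. *)
Lemma integral_rotation (R : realType) (c s : R) (h : R * R -> \bar R) :
  c ^+ 2 + s ^+ 2 = 1 -> measurable_fun setT h -> (forall x, 0 <= h x)%E ->
  (\int[lebesgue2 R]_p h ((c * p.1 - s * p.2)%R, (s * p.1 + c * p.2)%R)
   = \int[lebesgue2 R]_p h p)%E.
Proof.
wlog c1 : c s h / c != -1 => [wlg cs mh h0|cs mh h0].
  have [c1|] := eqVneq c (-1); last by move=> /wlg; apply.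
  have s0 : s = 0 by apply/eqP; rewrite -sqrf_eq0; apply/eqP; rewrite c1 in cs; lra.
  have q0 : (0 : R) != -1 by rewrite eq_sym oppr_eq0 oner_eq0.
  have e : (0 : R) ^+ 2 + 1 ^+ 2 = 1 by rewrite expr0n expr1n add0r.
  rewrite -[RHS](wlg 0 1 h q0 e mh h0) -[RHS](wlg 0 1 _ q0 e _ _)//; last first.
    apply: measurableT_comp => //; apply/measurable_fun_pairP; split => /=.
      by under eq_fun do rewrite -mulNr; exact: measurable_linear2.
    exact: measurable_linear2.
  by apply: eq_integral => -[x y] _ /=; congr (h (_, _)); rewrite c1 s0; ring.
have d : 1 + c != 0 by apply: contraNneq c1 => d; apply/eqP; lra.
pose t := s / (1 + c).
have m1 g : measurable_fun setT g -> measurable_fun setT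
    (fun p : R * R => g ((- t * p.2 + p.1)%R, p.2) : \bar R).
  move=> mg; apply: measurableT_comp => //; apply/measurable_fun_pairP; split => /=.
    by under eq_fun do rewrite addrC -[X in X + _]mul1r; exact: measurable_linear2.
  exact: measurable_snd.
have m2 g : measurable_fun setT g -> measurable_fun setT
    (fun p : R * R => g (p.1, (s * p.1 + p.2)%R) : \bar R).
  move=> mg; apply: measurableT_comp => //; apply/measurable_fun_pairP; split => /=.
    exact: measurable_fst.
  by under eq_fun do rewrite -[X in _ + X]mul1r; exact: measurable_linear2.
rewrite -[RHS](integral_shear1 (- t) mh)// -[RHS](integral_shear2 s (m1 _ mh))//.
rewrite -[RHS](integral_shear1 (- t) (m2 _ (m1 _ mh)))//.
have st : s * t = 1 - c.
  by rewrite mulrA -expr2 -(addKr (c ^+ 2) (s ^+ 2)) cs; field.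
have tc : t * (1 + c) = s by rewrite divfK.
apply: eq_integral => -[x y] _ /=; congr (h (_, _)).
  have -> : - t * (s * (- t * y + x) + y) + (- t * y + x)
    = (1 - s * t) * x - t * (1 + (1 - s * t)) * y :> R by ring.
  by rewrite st opprB addrCA subrr addr0 tc.
have -> : s * (- t * y + x) + y = s * x + (1 - s * t) * y :> R by ring.
by rewrite st opprB addrCA subrr addr0.
Qed.

(** * Areas of disks and radial integrals *)

Lemma is_derive_derivable_oo (R : realType) (F f : R -> R) (a b : R) :
  (forall x : R, is_derive x 1 F (f x)) -> derivable_oo_LRcontinuous F a b.
Proof.
move=> dF; have cF x : {for x, continuous F}.
  by apply: differentiable_continuous; apply/derivable1_diffP; exact: ex_derive.
split=> [x _| |]; first exact: ex_derive.
- by apply: cvg_at_right_filter; exact: cF.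
- by apply: cvg_at_left_filter; exact: cF.
Qed.

Lemma integral_of_derivative (R : realType) (F f : R -> R) (a b : R) :
  (forall x : R, is_derive x 1 F (f x)) -> continuous f -> a <= b ->
  (\int[@lebesgue_measure R]_(x in `[a, b]) (f x)%:E = (F b - F a)%:E)%E.
Proof.
move=> dF cf; rewrite le_eqVlt => /predU1P[->|ab].
  by rewrite set_itv1 integral_set1 subrr.
rewrite (@continuous_FTC2 _ f F)// ?EFinB//.
- by apply: continuous_subspaceT.
- exact: (is_derive_derivable_oo _ _ dF).
- by move=> x _; rewrite derive1E derive_val.
Qed.

(** Substituting x = rho sin(theta) keeps everything smooth up to the end points,
    where the arcsine primitive is not differentiable. *)
Lemma integral_chord_length (R : realType) (rho : R) : 0 < rho ->
  (\int[@lebesgue_measure R]_(x in `[(- rho)%R, rho])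
     (2 * Num.sqrt (rho ^+ 2 - x ^+ 2))%R%:E = (pi * rho ^+ 2)%R%:E)%E.
Proof.
move=> rho0; pose F (x : R) := rho * sin x; pose f (x : R) := rho * cos x.
have dF (x : R) : is_derive x 1 F (f x) by apply: is_derive_eq.
have cf : continuous f.
  by move=> x; apply: continuousM; [exact: cst_continuous|exact: continuous_cos].
have FE : derive1 F = f by apply/funext => x; rewrite derive1E derive_val.
have pi2 : - (pi / 2) <= pi / 2 :> R.
  by rewrite -subr_ge0 opprK addr_ge0// divr_ge0// pi_ge0.
have Fpi : F (pi / 2) = rho by rewrite /F sin_pihalf mulr1.
have FNpi : F (- (pi / 2)) = - rho by rewrite /F sinN sin_pihalf mulrN1.
have cG : continuous (fun x : R => 2 * Num.sqrt (rho ^+ 2 - x ^+ 2)).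
  move=> x; apply: cvgM; first exact: cvg_cst.
  apply: continuous_cvg; first exact: sqrt_continuous.
  by apply: cvgB; [exact: cvg_cst|exact: exprn_continuous].
rewrite -{1}FNpi -{1}Fpi integration_by_substitution_increasing//; first last.
- exact: continuous_subspaceT.
- exact: (is_derive_derivable_oo _ _ dF).
- by rewrite FE; apply/cvg_ex; exists (f (pi / 2)); apply: cvg_at_left_filter; exact: cf.
- by rewrite FE; apply/cvg_ex; exists (f (- (pi / 2))); apply: cvg_at_right_filter; exact: cf.
- by move=> x _; rewrite FE; exact: cf.
- by move=> x y xI yI xy; rewrite /F ltr_pM2l// ltr_sin.
pose G (x : R) := rho ^+ 2 * (x + sin x * cos x).
pose g (x : R) := 2 * rho ^+ 2 * cos x ^+ 2.
have dG (x : R) : is_derive x 1 G (g x).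
  apply: is_derive_eq; rewrite /g /GRing.scale /=.
  by rewrite mulrN -expr2 sin2cos2; ring.
have cg : continuous g.
  move=> x; apply: cvgM; first exact: cvg_cst.
  apply: (@cvg_comp _ _ _ cos (fun y : R => y ^+ 2) _ (nbhs (cos x))).
    exact: continuous_cos.
  exact: exprn_continuous.
have key (x : R) : - (pi / 2) <= x <= pi / 2 ->
    2 * Num.sqrt (rho ^+ 2 - (rho * sin x) ^+ 2) * (rho * cos x) = g x.
  move=> xI; rewrite exprMn -{1}[rho ^+ 2]mulr1 -mulrBr -cos2sin2 -exprMn sqrtr_sqr.
  rewrite ger0_norm ?mulr_ge0 ?(ltW rho0) ?cos_ge0_pihalf// /g; ring.
transitivity (\int[@lebesgue_measure R]_(x in `[(- (pi / 2))%R, (pi / 2)%R]) (g x)%:E)%E.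
  apply: eq_integral => x; rewrite inE /= in_itv /= => xI; congr EFin.
  by rewrite FE -key.
rewrite (integral_of_derivative dG cg pi2); congr EFin.
by rewrite /G cosN cos_pihalf !mulr0 !addr0; field.
Qed.

(** The vertical section at x has length 2 sqrt(t - x^2) for every x, because the
    square root of a negative number is 0 by convention. *)
Lemma measure_disk (R : realType) (t : R) :
  lebesgue2 R [set p | p.1 ^+ 2 + p.2 ^+ 2 <= t] = (pi * Num.max t 0)%:E.
Proof.
have sec x : lebesgue_measure (xsection [set p : R * R | p.1 ^+ 2 + p.2 ^+ 2 <= t] x)
             = (2 * Num.sqrt (t - x ^+ 2))%:E.
  have [tx|xt] := ltP t (x ^+ 2).
    rewrite (_ : xsection _ x = set0) ?measure0.
      by rewrite ler0_sqrtr ?mulr0// subr_le0 ltW.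
    apply/seteqP; split=> y //=; rewrite /xsection /= inE /= => h.
    have := sqr_ge0 y; lra.
  set s := Num.sqrt _; have s0 : 0 <= s := sqrtr_ge0 _.
  have s2 : s ^+ 2 = t - x ^+ 2 by rewrite sqr_sqrtr// subr_ge0.
  rewrite (_ : xsection _ x = `[- s, s]%classic).
    rewrite lebesgue_measure_itv /= lte_fin; case: ifPn => [_|].
      by rewrite -EFinB; congr EFin; ring.
    by rewrite -leNgt => h; congr EFin; lra.
  apply/seteqP; split=> y; rewrite /xsection /= inE /= in_itv /= => h.
    rewrite -ler_norml -(ler_pXn2r (n := 2))// ?nnegrE// -normrX ger0_norm ?sqr_ge0//.
    by rewrite s2; lra.
  move: h; rewrite -ler_norml -(ler_pXn2r (n := 2))// ?nnegrE// -normrX ger0_norm ?sqr_ge0//.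
  by rewrite s2; lra.
rewrite /product_measure1 /=.
under eq_integral do rewrite sec.
have [t0|t0] := leP t 0.
  rewrite mulr0 integral0_eq// => x _; congr EFin.
  by rewrite ler0_sqrtr ?mulr0// subr_le0 (le_trans t0)// sqr_ge0.
pose rho := Num.sqrt t.
have rho0 : 0 < rho by rewrite sqrtr_gt0.
have rho2 : rho ^+ 2 = t by rewrite sqr_sqrtr// ltW.
have := integral_chord_length rho0; rewrite rho2 => <-.
rewrite [RHS]integral_mkcond; apply: eq_integral => x _; rewrite patchE.
case: ifPn => //; rewrite notin_setE /= in_itv /= => /negP; rewrite -ler_norml -ltNge => h.
congr EFin; rewrite ler0_sqrtr ?mulr0// subr_le0 -rho2.
by rewrite -[leRHS]ger0_norm ?sqr_ge0// normrX ler_pXn2r ?nnegrE// ltW.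
Qed.

Lemma measure_eq_ocitv (R : realType)
    (m1 m2 : {measure set (measurableTypeR R) -> \bar R}) :
  (forall a b : R, m1 `]a, b]%classic = m2 `]a, b]%classic) ->
  (forall a b : R, (m1 `]a, b]%classic < +oo)%E) ->
  forall A, measurable A -> m1 A = m2 A.
Proof.
move=> m12 m1oo A mA.
refine (@measure_unique _ R (measurableTypeR R) (@ocitv R) (fun k => `](- k%:R)%R, k%:R]%classic) _ _ _ _ m1 m2 _ _ A mA) => //.
- exact: ocitvI.
- by move=> k; exists (- k%:R, k%:R).
- exact: bigcup_itvT.
- by move=> _ [[a b] _ <-]; exact: m12.
Qed.

Lemma measurable_sqr_modulus (R : realType) :
  measurable_fun setT (fun p : R * R => p.1 ^+ 2 + p.2 ^+ 2).
Proof. by apply: measurable_funD; apply: measurable_funX. Qed.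

Lemma measurable_closed_disk (R : realType) (t : R) :
  measurable [set p : R * R | p.1 ^+ 2 + p.2 ^+ 2 <= t].
Proof.
rewrite -[X in measurable X]setTI.
apply: (@measurable_sqr_modulus R measurableT [set y | y <= t]).
by rewrite -set_itvNyc; exact: measurable_itv.
Qed.

Lemma measure_annulus (R : realType) (a b : R) :
  lebesgue2 R [set p | a < p.1 ^+ 2 + p.2 ^+ 2 <= b]
  = (pi%:E * lebesgue_measure ((`]a, b] `&` `[0%R, +oo[)%classic : set R))%E.
Proof.
have [ba|ab] := leP b a.
  rewrite (_ : [set p | _] = set0) ?measure0; last first.
    by apply/seteqP; split=> p //= /andP[ap pb]; have := lt_le_trans ap (le_trans pb ba); rewrite ltxx.
  by rewrite set_itv_ge ?set0I ?measure0 ?mule0// bnd_simp -leNgt.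
rewrite (_ : [set p | _] = [set p : R * R | p.1 ^+ 2 + p.2 ^+ 2 <= b]
    `\` [set p | p.1 ^+ 2 + p.2 ^+ 2 <= a]); last first.
  apply/seteqP; split=> p /=; first by move=> /andP[ap ->]; split=> //; apply/negP; rewrite -ltNge.
  by move=> [-> /negP]; rewrite -ltNge => ->.
rewrite measureD; try exact: measurable_closed_disk; last first.
  by rewrite [ltLHS]measure_disk ltry.
rewrite (_ : _ `&` _ = [set p : R * R | p.1 ^+ 2 + p.2 ^+ 2 <= a]); last first.
  by apply/setIidr => p /= /le_trans; apply; exact: ltW.
rewrite [X in (X - _)%E]measure_disk [X in (_ - X)%E]measure_disk -EFinB -mulrBr EFinM; congr (_ * _)%E.
have [a0|a0] := ltP a 0.
  have -> : (`]a, b] `&` `[0, +oo[ = `[0, b])%classic.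
    apply/seteqP; split=> x /=; rewrite !in_itv /= ?andbT.
      by move=> [/andP[_ ->] ->].
    by move=> /andP[x0 xb]; rewrite xb x0 (lt_le_trans a0).
  rewrite lebesgue_measure_itv /= lte_fin subr0.
  by case: ltP => h; rewrite ?oppr0 ?addr0.
have -> : (`]a, b] `&` `[0, +oo[ = `]a, b])%classic.
  apply/setIidl => x /=; rewrite !in_itv /= andbT => /andP[/ltW ax _].
  exact: le_trans ax.
rewrite lebesgue_measure_itv /= lte_fin ab -EFinB; congr EFin.
by case: ltP => // h; lra.
Qed.

(** The image of plane measure under the squared modulus is pi times Lebesgue
    measure on the half-line: by the area of annuli they agree on half-open
    intervals. *)
Lemma pushforward_sqr_modulus (R : realType) (A : set R) :
  measurable A -> A `<=` [set x | 0 <= x] ->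
  lebesgue2 R [set p | A (p.1 ^+ 2 + p.2 ^+ 2)] = (pi%:E * lebesgue_measure A)%E.
Proof.
move=> mA A0.
have mphi := @measurable_sqr_modulus R.
have mpos : measurable (`[0, +oo[%classic : set R) by exact: measurable_itv.
have pi0 : 0 <= pi :> R by exact: pi_ge0.
transitivity (mscale (NngNum pi0) (mrestr (@lebesgue_measure R) mpos) A); last first.
  rewrite /mscale /mrestr /=; congr (_ * lebesgue_measure _)%E.
  by apply/setIidl => x /A0; rewrite /= in_itv /= andbT.
change (pushforward (lebesgue2 R) (fun p : R * R => p.1 ^+ 2 + p.2 ^+ 2 : measurableTypeR R) A
  = mscale (NngNum pi0) (mrestr (@lebesgue_measure R) mpos) A).
have annulus (a b : R) :
    pushforward (lebesgue2 R) (fun p : R * R => p.1 ^+ 2 + p.2 ^+ 2 : measurableTypeR R)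
      `]a, b]%classic
    = mscale (NngNum pi0) (mrestr (@lebesgue_measure R) mpos) `]a, b]%classic.
  by rewrite /mscale /mrestr /= -measure_annulus.
apply: measure_eq_ocitv => //.
move=> a b; apply: (le_lt_trans (_ : (_ <= mscale (NngNum pi0) (mrestr (@lebesgue_measure R) mpos) `]a, b]%classic)%E)).
  by rewrite -annulus.
rewrite /mscale /mrestr /= lte_mul_pinfty//.
apply: le_lt_trans (_ : (lebesgue_measure (`]a, b]%classic : set R) < +oo)%E).
  apply: le_measure; rewrite ?inE; [exact: measurableI|exact: measurable_itv|exact: subIsetl].
by rewrite lebesgue_measure_itv /=; case: ifP => _; rewrite -?EFinB ltry.
Qed.

(** A change of variables: t = |z|^2 reduces the integral to that of pi t^k over
    the interval from 0 to r^2. *)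
Lemma integral_modulus_pow (R : realType) (r : R) k : 0 <= r ->
  (\int[lebesgue2 R]_(p in [set p : R * R | (p.1 ^+ 2 + p.2 ^+ 2 < r ^+ 2)%R])
    ((p.1 ^+ 2 + p.2 ^+ 2) ^+ k)%R%:E = (pi / k.+1%:R * r ^+ (2 * k.+1))%R%:E)%E.
Proof.
move=> r0; have mphi := @measurable_sqr_modulus R.
pose phi (p : R * R) : measurableTypeR R := p.1 ^+ 2 + p.2 ^+ 2.
have pi0 : 0 <= pi :> R by exact: pi_ge0.
pose D := (`[0, r ^+ 2[%classic : set R).
have mD : measurable D by exact: measurable_itv.
have mpow : measurable_fun D (fun t : R => (t ^+ k)%:E).
  by apply/measurable_EFinP; apply: measurable_funX.
transitivity (\int[lebesgue2 R]_(p in phi @^-1` D) ((phi p) ^+ k)%R%:E)%E.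
  rewrite (_ : [set p | _] = phi @^-1` D)//.
  apply/seteqP; split=> p; rewrite /D /= in_itv /=; last by move=> /andP[].
  by move=> ->; rewrite andbT addr_ge0 ?sqr_ge0.
transitivity (\int[pushforward (lebesgue2 R) phi]_(t in D) (t ^+ k)%R%:E)%E.
  symmetry.
  refine (@ge0_integral_pushforward _ _ (measurableTypeR R * measurableTypeR R)%type (measurableTypeR R) R phi mphi (lebesgue2 R) D (fun t => (t ^+ k)%:E) mD mpow _).
  by move=> t; rewrite inE /D /= in_itv /= lee_fin => /andP[t0 _]; rewrite exprn_ge0.
transitivity (\int[mscale (NngNum pi0) (@lebesgue_measure R)]_(t in D) (t ^+ k)%R%:E)%E.
  apply: eq_measure_integral => A mA AD.
  apply: pushforward_sqr_modulus => // x /AD; rewrite /D /= in_itv /=.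
  by move=> /andP[].
rewrite ge0_integral_mscale//; last first.
  by move=> t; rewrite /D /= in_itv /= lee_fin => /andP[t0 _]; rewrite exprn_ge0.
rewrite /D integral_itv_bndo_bndc//.
have dP (t : R) : is_derive t 1 (fun t : R => k.+1%:R^-1 * t ^+ k.+1) (t ^+ k).
  have -> : (fun t : R => k.+1%:R^-1 * t ^+ k.+1) = k.+1%:R^-1 *: (id ^+ k.+1 : R -> R).
    by apply/funext => x; rewrite fctE.
  by apply: is_derive_eq; rewrite /GRing.scale /= mulr1 mulKf.
rewrite (integral_of_derivative dP (@exprn_continuous R k) (sqr_ge0 r)).
rewrite expr0n mulr0 subr0 -EFinM; congr EFin.
by rewrite exprM mulrA.
Qed.

(** * The area formula *)

(** The domain of integration of image_area. *)
Definition disk (R : realType) (r : R) : set (R * R) :=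
  [set p | cmod (p.1 +i* p.2) < r].

Lemma diskE (R : realType) (r : R) : 0 <= r ->
  disk r = [set p | p.1 ^+ 2 + p.2 ^+ 2 < r ^+ 2].
Proof.
move=> r0; apply/seteqP; split=> p /=; rewrite /disk /=.
  by move=> h; rewrite -[ltLHS](sqr_cmod (p.1 +i* p.2)) ltr_pXn2r ?nnegrE ?cmod_ge0.
by rewrite -[ltLHS](sqr_cmod (p.1 +i* p.2)) ltr_pXn2r ?nnegrE ?cmod_ge0.
Qed.

Lemma measurable_disk (R : realType) (r : R) : 0 <= r -> measurable (disk r).
Proof.
move=> r0; rewrite diskE// -[X in measurable X]setTI.
apply: (@measurable_sqr_modulus R measurableT [set y | y < r ^+ 2]).
by rewrite -set_itvNyo; exact: measurable_itv.
Qed.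

(** Borel measurability of a complex function, expressed by its two real
    components. *)
Definition cmeasurable (R : realType) (g : R * R -> R[i]) : Prop :=
  measurable_fun setT (fun p => complex.Re (g p)) /\
  measurable_fun setT (fun p => complex.Im (g p)).

Lemma cmeasurable_cst (R : realType) (c : R[i]) : cmeasurable (fun=> c : R[i]).
Proof. by split; exact: measurable_cst. Qed.

Lemma cmeasurable_id (R : realType) : cmeasurable (fun p : R * R => p.1 +i* p.2).
Proof. by split=> /=; [exact: measurable_fst|exact: measurable_snd]. Qed.

Lemma cmeasurableD (R : realType) (g h : R * R -> R[i]) :
  cmeasurable g -> cmeasurable h -> cmeasurable (fun p => g p + h p).
Proof.
move=> [g1 g2] [h1 h2]; split.
  rewrite (_ : (fun p => _) = (fun p => complex.Re (g p) + complex.Re (h p))).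
    exact: measurable_funD.
  by apply/funext => p; case: (g p) (h p) => ? ? [].
rewrite (_ : (fun p => _) = (fun p => complex.Im (g p) + complex.Im (h p))).
  exact: measurable_funD.
by apply/funext => p; case: (g p) (h p) => ? ? [].
Qed.

Lemma cmeasurableM (R : realType) (g h : R * R -> R[i]) :
  cmeasurable g -> cmeasurable h -> cmeasurable (fun p => g p * h p).
Proof.
move=> [g1 g2] [h1 h2]; split.
  rewrite (_ : (fun p => _) = (fun p => complex.Re (g p) * complex.Re (h p)
                                        - complex.Im (g p) * complex.Im (h p))).
    by apply: measurable_funB; exact: measurable_funM.
  by apply/funext => p; case: (g p) (h p) => ? ? [].
rewrite (_ : (fun p => _) = (fun p => complex.Re (g p) * complex.Im (h p)
                                      + complex.Im (g p) * complex.Re (h p))).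
  by apply: measurable_funD; exact: measurable_funM.
by apply/funext => p; case: (g p) (h p) => ? ? [].
Qed.

Lemma cmeasurable_horner (R : realType) (q : {poly R[i]}) (g : R * R -> R[i]) :
  cmeasurable g -> cmeasurable (fun p => q.[g p]).
Proof.
move=> mg; elim/poly_ind: q => [|q c IH].
  by under [X in cmeasurable X]eq_fun do rewrite horner0; exact: cmeasurable_cst.
under [X in cmeasurable X]eq_fun do rewrite hornerMXaddC.
by apply: cmeasurableD; [exact: cmeasurableM|exact: cmeasurable_cst].
Qed.

Lemma measurable_cmod2 (R : realType) (g : R * R -> R[i]) :
  cmeasurable g -> measurable_fun setT (fun p => cmod (g p) ^+ 2).
Proof.
move=> [g1 g2]; under eq_fun do rewrite sqr_cmod.
by apply: measurable_funD; exact: measurable_funX.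
Qed.

Lemma integral_disk_rotation (R : realType) (r : R) (w : R[i]) (h : R[i] -> R) :
  0 <= r -> cmod w = 1 -> (forall z, 0 <= h z) ->
  measurable_fun setT (fun p : R * R => h (p.1 +i* p.2)) ->
  (\int[lebesgue2 R]_(p in disk r) (h (w * (p.1 +i* p.2)))%:E
   = \int[lebesgue2 R]_(p in disk r) (h (p.1 +i* p.2))%:E)%E.
Proof.
move=> r0 w1 h0 mh; case: w w1 => c s w1.
have cs : c ^+ 2 + s ^+ 2 = 1 by rewrite -[LHS](sqr_cmod (c +i* s)) w1 expr1n.
rewrite [LHS]integral_mkcond [RHS]integral_mkcond.
set H := (X in _ = (\int[_]_(p in _) X p)%E).
have mH : measurable_fun setT H.
  apply/(measurable_restrictT _ (measurable_disk r0)).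
  by apply/measurable_EFinP; apply: measurable_funTS.
have H0 p : (0 <= H p)%E by rewrite /H patchE; case: ifP; rewrite ?lee_fin.
rewrite -(integral_rotation cs mH H0).
apply: eq_integral => -[x y] _; rewrite /H /= !patchE /=.
have e : (c * x - s * y) +i* (s * x + c * y) = (c +i* s) * (x +i* y).
  by rewrite [RHS]/GRing.mul /= [s * x + _]addrC.
have -> : ((x, y) \in disk r) = ((c * x - s * y, s * x + c * y) \in disk r).
  by apply/idP/idP; rewrite !inE /disk /= e cmodM w1 mul1r.
by case: ifP => // _; rewrite /= e.
Qed.

(** The average of |q(w z)|^2 over the roots of unity w is the sum of the
    |q_k|^2 |z|^(2k), and by rotation invariance each term of the average has the
    same integral. *)
Lemma parseval_disk (R : realType) (r : R) (q : {poly R[i]}) n :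
  0 <= r -> (size q <= n)%N ->
  (\int[lebesgue2 R]_(p in disk r) (cmod q.[p.1 +i* p.2] ^+ 2)%R%:E
   = (\sum_(k < n) cmod q`_k ^+ 2 * (pi / k.+1%:R * r ^+ (2 * k.+1)))%R%:E)%E.
Proof.
move=> r0 qn; have [N [nN [w wN]]] := prim_root_exists R[i] n.
have w1 j : cmod (w ^+ j) = 1 by rewrite cmodX (cmod_prim_root wN) expr1n.
have mD := measurable_disk r0.
have mid := cmeasurable_id R.
have mq j : measurable_fun setT (fun p : R * R => cmod q.[w ^+ j * (p.1 +i* p.2)] ^+ 2).
  apply: measurable_cmod2; apply: cmeasurable_horner; apply: cmeasurableM.
    exact: cmeasurable_cst.
  exact: mid.
have N0 : N%:R != 0 :> R by rewrite pnatr_eq0 -lt0n (prim_order_gt0 wN).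
have avg (p : R * R) : \sum_(k < n) cmod q`_k ^+ 2 * (p.1 ^+ 2 + p.2 ^+ 2) ^+ k
    = \sum_(j < N) N%:R^-1 * cmod q.[w ^+ j * (p.1 +i* p.2)] ^+ 2.
  rewrite -mulr_sumr (parseval_prim_root _ wN qn nN) mulKf//.
  by apply: eq_bigr => k _; rewrite exprM (sqr_cmod (p.1 +i* p.2)).
transitivity (\int[lebesgue2 R]_(p in disk r)
   (\sum_(k < n) cmod q`_k ^+ 2 * (p.1 ^+ 2 + p.2 ^+ 2) ^+ k)%R%:E)%E.
  under [RHS]eq_integral do rewrite avg -sumEFin.
  rewrite ge0_integral_sum//; last 2 first.
  - move=> j; apply/measurable_EFinP; apply: measurable_funTS.
    by apply: measurable_funM; [exact: measurable_cst|exact: mq].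
  - by move=> j p _; rewrite lee_fin mulr_ge0 ?sqr_ge0// invr_ge0.
  rewrite (eq_bigr (fun=> (N%:R^-1)%:E * \int[lebesgue2 R]_(p in disk r)
    (cmod q.[p.1 +i* p.2] ^+ 2)%R%:E)%E); last first.
    move=> j _; under eq_integral do rewrite EFinM.
    rewrite ge0_integralZl//; last 2 first.
    - by apply/measurable_EFinP; apply: measurable_funTS; exact: mq.
    - by move=> p _; rewrite lee_fin sqr_ge0.
    congr (_ * _)%E; apply: (integral_disk_rotation (h := fun z => cmod q.[z] ^+ 2)) => //.
      by move=> z; rewrite sqr_ge0.
    by apply: measurable_cmod2; exact: cmeasurable_horner.
  rewrite -ge0_sume_distrl; last by move=> j _; rewrite lee_fin invr_ge0.
  by rewrite sumEFin sumr_const card_ord -[X in (X *+ _)%:E]mul1r -mulrnAr -[_ *+ N]mulr_natl mul1r divff// mul1e.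
under eq_integral do rewrite -sumEFin.
have mphi := @measurable_sqr_modulus R.
rewrite ge0_integral_sum//; last 2 first.
- move=> k; apply/measurable_EFinP; apply: measurable_funTS.
  by apply: measurable_funM => //; exact: measurable_funX.
- move=> k p _; rewrite lee_fin mulr_ge0 ?sqr_ge0// exprn_ge0// addr_ge0//; exact: sqr_ge0.
rewrite -sumEFin; apply: eq_bigr => k _.
under eq_integral do rewrite EFinM.
rewrite ge0_integralZl ?lee_fin ?sqr_ge0//.
- rewrite diskE// [RHS]EFinM; congr (_ * _)%E; exact: integral_modulus_pow.
- by apply/measurable_EFinP; apply: measurable_funTS; exact: measurable_funX.
- by move=> p _; rewrite lee_fin exprn_ge0// addr_ge0//; exact: sqr_ge0.
Qed.

(** Completeness comes from R: the limit is assembled from those of the real and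
    imaginary parts. *)
Lemma cvg_abs_series (R : realType) (c : nat -> R[i]) (C : R) :
  (forall n, \sum_(k < n) cmod (c k) <= C) ->
  exists l : R[i]^o, series (fun k => c k : R[i]^o) @ \oo --> l.
Proof.
move=> cC.
have real_case (x : nat -> R) : (forall k, `|x k| <= cmod (c k)) ->
    exists l : R, series x @ \oo --> l.
  move=> xc; apply/cvg_ex/normed_cvg.
  apply: nondecreasing_is_cvgn.
    by apply: nondecreasing_series => n _ _; rewrite /=.
  exists C => _ [n _ <-]; rewrite /= seriesEord; apply: le_trans (cC n).
  exact: ler_sum.
have norm_part k : `|complex.Re (c k)| <= cmod (c k) /\ `|complex.Im (c k)| <= cmod (c k).
  have h := sqr_cmod (c k).
  split; rewrite -(@ler_pXn2r _ 2)// ?nnegrE ?cmod_ge0// real_normK ?num_real// h.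
    by rewrite lerDl sqr_ge0.
  by rewrite lerDr sqr_ge0.
have [x cx] := real_case (fun k => complex.Re (c k)) (fun k => (norm_part k).1).
have [y cy] := real_case (fun k => complex.Im (c k)) (fun k => (norm_part k).2).
exists (x +i* y); apply/cvg_cmodP => e e0.
have e2 : 0 < e / 2 by rewrite divr_gt0.
have /cvgrPdist_lt /(_ _ e2) hx := cx; have /cvgrPdist_lt /(_ _ e2) hy := cy.
near=> n.
have hx1 : `|x - series (fun k => complex.Re (c k)) n| < e / 2 by near: n.
have hy1 : `|y - series (fun k => complex.Im (c k)) n| < e / 2 by near: n.
have -> : series (fun k => c k : R[i]^o) n - (x +i* y)
    = (series (fun k => complex.Re (c k)) n - x)%:C
      + 'i%C * (series (fun k => complex.Im (c k)) n - y)%:C.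
  rewrite !seriesEord /= !rmorphB !rmorph_sum /= mulrBr mulr_sumr.
  rewrite addrACA -big_split /= (complexE (x +i* y)) /= opprD.
  by congr (_ + _); apply: eq_bigr => k _; rewrite -complexE.
apply: le_lt_trans (cmodD _ _) _.
rewrite cmodM !cmodR (_ : cmod 'i%C = 1); last first.
  by rewrite /cmod normc_def /= expr0n expr1n add0r sqrtr1.
by rewrite mul1r distrC [X in _ + X]distrC [e]splitr ltrD.
Unshelve. all: by end_near. Qed.

(** The remainders D_k = w^(k+1) - z^(k+1) - (w - z) (k+1) z^k satisfy
    D_(k+1) = w D_k + (w - z)^2 (k+1) z^k.  Summing the moduli bounds the sum X
    by s X + |w - z|^2 (1 - s)^-2. *)
Lemma sum_power_remainder_le (R : realType) (z w : R[i]) (s : R) n :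
  s < 1 -> cmod z <= s -> cmod w <= s ->
  \sum_(k < n) cmod (w ^+ k.+1 - z ^+ k.+1 - (w - z) * (k.+1%:R * z ^+ k))
  <= cmod (w - z) ^+ 2 * (1 - s) ^- 3.
Proof.
move=> s1 zs ws; have s0 : 0 <= s := le_trans (cmod_ge0 z) zs.
have s1' : 0 < 1 - s by rewrite subr_gt0.
pose D k := w ^+ k.+1 - z ^+ k.+1 - (w - z) * (k.+1%:R * z ^+ k).
set B := leRHS.
have B0 : 0 <= B by rewrite mulr_ge0 ?sqr_ge0// invr_ge0 exprn_ge0// ltW.
have DS k : D k.+1 = w * D k + (w - z) ^+ 2 * (k.+1%:R * z ^+ k).
  by rewrite /D !exprS -[in k.+2%:R]natr1; ring.
elim: n => [|n IH]; first by rewrite big_ord0.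
rewrite big_ord_recl /= {1}expr0 !expr1 !mulr1 subrr cmod0 add0r.
apply: (@le_trans _ _ (\sum_(k < n) (s * cmod (D k) + cmod (w - z) ^+ 2 * (k.+1%:R * s ^+ k)))).
  apply: ler_sum => k _; rewrite -[X in cmod X]/(D k.+1) DS.
  apply: (le_trans (cmodD _ _)); rewrite !cmodM !cmodX cmod_nat lerD//.
    by rewrite ler_wpM2r ?cmod_ge0.
  by rewrite ler_wpM2l ?sqr_ge0// ler_wpM2l// lerXn2r ?nnegrE ?cmod_ge0.
rewrite big_split /= -!mulr_sumr.
apply: (@le_trans _ _ (s * B + cmod (w - z) ^+ 2 * (1 - s) ^- 2)).
  rewrite lerD//; first by rewrite ler_wpM2l.
  by rewrite ler_wpM2l ?sqr_ge0// sum_geo_deriv_le// s0.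
rewrite (_ : _ ^- 2 = (1 - s) * (1 - s) ^- 3); last by field; rewrite gt_eqF.
by rewrite [cmod _ ^+ 2 * _]mulrCA -/B -mulrDl addrC subrK mul1r.
Qed.

(** The series of derivatives converges absolutely.  The remainder estimate then
    passes to the limit and shows that the difference quotient at h differs from
    its sum by at most a constant times |h|. *)
Lemma derive_power_series (R : realType) (f : R[i]^o -> R[i]^o) (a : nat -> R[i]) (z : R[i]) :
  power_series_on_disk f a -> (forall k, cmod (a k) <= 1) -> cmod z < 1 ->
  series (fun k => k.+1%:R * a k.+1 * z ^+ k : R[i]^o) @ \oo --> derive1 f z.
Proof.
move=> fa a1 z1; pose s := (1 + cmod z) / 2.
have z0 := cmod_ge0 z.
have s1 : s < 1 by rewrite /s; lra.
have zs : cmod z <= s by rewrite /s; lra.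
have [g cg] : exists l : R[i]^o, series (fun k => k.+1%:R * a k.+1 * z ^+ k : R[i]^o) @ \oo --> l.
  apply: (@cvg_abs_series _ _ ((1 - cmod z) ^- 2)) => n.
  have z01 : 0 <= cmod z < 1 by rewrite z0.
  apply: le_trans (sum_geo_deriv_le n z01); apply: ler_sum => k _.
  by rewrite !cmodM cmod_nat cmodX -mulrA ler_wpM2l// ler_piMl// exprn_ge0.
suff -> : derive1 f z = g by [].
have bound w : cmod w <= s -> cmod (f w - f z - (w - z) * g) <= cmod (w - z) ^+ 2 * (1 - s) ^- 3.
  move=> ws.
  have cF v : cmod v < 1 -> (fun n => series (fun k => a k * v ^+ k : R[i]^o) n.+1) @ \oo --> f v.
    by move=> v1; rewrite (cvg_shiftS (series (fun k => a k * v ^+ k : R[i]^o))); exact: fa.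
  apply: (@le_cmod_cvg _ _ \oo _ (fun n =>
    series (fun k => a k * w ^+ k : R[i]^o) n.+1 - series (fun k => a k * z ^+ k : R[i]^o) n.+1
    - (w - z) * series (fun k => k.+1%:R * a k.+1 * z ^+ k : R[i]^o) n)).
    apply: cvgB; first by apply: cvgB; apply: cF => //; exact: le_lt_trans s1.
    by apply: cvgMr.
  near=> n; apply: le_trans (sum_power_remainder_le n s1 zs ws).
  rewrite !seriesEord /= !big_ord_recl /= !expr0 opprD addrACA subrr add0r.
  rewrite mulr_sumr -!sumrB.
  apply: le_trans (cmod_sum _ _ _) _; apply: ler_sum => k _.
  rewrite [X in cmod X](_ : _ = a k.+1 * (w ^+ k.+1 - z ^+ k.+1 - (w - z) * (k.+1%:R * z ^+ k))).
    by rewrite cmodM ler_piMl ?cmod_ge0.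
  by rewrite /bump /= add1n; ring.
apply: (@cvg_lim _ (@norm_hausdorff _ R[i]^o)).
apply/cvg_cmodP => e e0.
have C0 : 0 < (1 - s) ^- 3 by rewrite invr_gt0 exprn_gt0// subr_gt0.
(* The first bound keeps z + h in the disk of radius s, the second makes the
   quadratic remainder smaller than e times |h|. *)
pose d := Num.min (s - cmod z) (e / (1 - s) ^- 3).
have d0 : 0 < d by rewrite lt_min divr_gt0// andbT /s; lra.
have : nbhs (0 : R[i]^o) [set h | cmod h < d].
  by have /cvg_cmodP/(_ _ d0) := @cvg_id _ (nbhs (0 : R[i]^o)); apply: filterS => h; rewrite subr0.
move=> hd; rewrite near_withinE; apply: filterS hd => h hd h0 /=.
have hd' : cmod h <= s - cmod z by apply/ltW; apply: lt_le_trans hd _; rewrite /d ge_min lexx.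
have hs : cmod (h + z) <= s by apply: le_trans (cmodD _ _) _; lra.
have h0' : 0 < cmod h.
  rewrite lt_neqAle cmod_ge0 andbT eq_sym; apply: contra h0 => /eqP ch.
  by rewrite -normr_eq0 -cmodE ch.
have := bound _ hs; rewrite addrK => bh.
have -> : h^-1 *: (f (h + z) - f z) - g = h^-1 * (f (h + z) - f z - h * g).
  by rewrite mulrBr mulKf.
rewrite cmodM cmodV ltr_pdivrMl//; apply: le_lt_trans bh _.
rewrite expr2 -mulrA ltr_pM2l// -ltr_pdivlMr//.
by apply: lt_le_trans hd _; rewrite /d ge_min lexx orbT.
Unshelve. all: by end_near. Qed.

(** Dominated convergence applied to the partial sums of the derivative, which
    |a_k| <= 1 bounds by (1 - r)^-2 on the disk. *)
Lemma image_area_cvg (R : realType) (f : R[i]^o -> R[i]^o) (a : nat -> R[i]) (r : R) :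
  power_series_on_disk f a -> (forall k, cmod (a k) <= 1) -> 0 <= r < 1 ->
  (fun n => (pi * \sum_(k < n) k.+1%:R * cmod (a k.+1) ^+ 2 * r ^+ (2 * k.+1))%:E)
    @ \oo --> image_area f r.
Proof.
move=> fa a1 /andP[r0 r1].
pose q n : {poly R[i]} := \poly_(k < n) (k.+1%:R * a k.+1).
pose u n (p : R * R) : \bar R := (cmod (q n).[p.1 +i* p.2] ^+ 2)%:E.
have mD := measurable_disk r0.
rewrite (_ : (fun n => _) = (fun n => (\int[lebesgue2 R]_(p in disk r) u n p)%E)); last first.
  apply/funext => n; rewrite /u (parseval_disk r0 (size_poly n _)); congr EFin.
  rewrite mulr_sumr; apply: eq_bigr => k _.
  rewrite coef_poly ltn_ord cmodM cmod_nat exprMn.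
  have K0 : (k.+1%:R : R) != 0 by rewrite pnatr_eq0.
  by move: (k.+1%:R) K0 => K K0; field.
have mu n : measurable_fun (disk r) (u n).
  apply/measurable_EFinP; apply: measurable_funTS; apply: measurable_cmod2.
  by apply: cmeasurable_horner; exact: cmeasurable_id.
have cu p : disk r p -> u ^~ p @ \oo --> (cmod (derive1 f (p.1 +i* p.2)) ^+ 2)%:E.
  move=> pr; apply/cvg_EFin; first exact: nearW.
  have z1 : cmod (p.1 +i* p.2) < 1 by apply: lt_trans r1.
  have := cvg_cmod _ (derive_power_series fa a1 z1).
  rewrite (_ : (fun n => _) = (fun n => cmod (q n).[p.1 +i* p.2])).
    by move=> /(_ _) h; rewrite expr2; exact: (cvgM h h).
  by apply/funext => m; rewrite seriesEord /= horner_poly.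
have bu n p : disk r p -> (`|u n p| <= ((1 - r) ^- 2 ^+ 2)%:E)%E.
  rewrite /disk /= => pr; have r01 : 0 <= r < 1 by rewrite r0.
  rewrite lee_fin ger0_norm ?sqr_ge0// lerXn2r ?nnegrE ?cmod_ge0//.
    by rewrite invr_ge0 exprn_ge0// subr_ge0 ltW.
  apply: le_trans (sum_geo_deriv_le n r01).
  rewrite horner_poly; apply: le_trans (cmod_sum _ _ _) _; apply: ler_sum => k _.
  rewrite !cmodM cmod_nat cmodX -mulrA ler_wpM2l//.
  rewrite -[leRHS]mul1r ler_pM ?cmod_ge0 ?exprn_ge0//.
    by rewrite cmod_ge0.
  by rewrite lerXn2r ?nnegrE ?cmod_ge0// ltW.
have mf : measurable_fun (disk r) (fun p : R * R => (cmod (derive1 f (p.1 +i* p.2)) ^+ 2)%:E).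
  by apply: (emeasurable_fun_cvg u) => // p; exact: cu.
have ig : (lebesgue2 R).-integrable (disk r) (cst ((1 - r) ^- 2 ^+ 2)%:E).
  apply/integrableP; split; first exact: measurable_cst.
  rewrite integral_cst// lte_mul_pinfty ?abse_ge0// ?abse_fin_num//.
  apply: (@le_lt_trans _ _ (lebesgue2 R [set p : R * R | p.1 ^+ 2 + p.2 ^+ 2 <= r ^+ 2])).
    apply: le_measure; rewrite ?inE.
    - exact: mD.
    - exact: measurable_closed_disk.
    - by rewrite diskE// => p /ltW.
  by rewrite [ltLHS]measure_disk ltry.
have [||_ _] := @dominated_convergence _ (measurableTypeR R * measurableTypeR R)%type R
  (lebesgue2 R) (disk r) mD u _ _ mu mf _ ig _.
- exact: aeW.
- by apply: aeW => p n; exact: bu.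
exact.
Qed.

(** * The inequalities *)

Lemma nneseries_EFin (R : realType) (x : nat -> R) m (l : R) :
  (fun n => \sum_(m <= k < n) x k) @ \oo --> l ->
  (\sum_(m <= k <oo) (x k)%:E = l%:E)%E.
Proof.
move=> cx; apply: cvg_lim => //.
rewrite (_ : (fun n => _) = (fun n => (\sum_(m <= k < n) x k)%R%:E)).
  by apply: cvg_EFin => //; exact: nearW.
by apply/funext => n; rewrite sumEFin.
Qed.

Lemma bohr_tail (R : realType) (a : nat -> R[i]) (r T : R) :
  (fun n => \sum_(k < n) cmod (a k.+1) * r ^+ k.+1) @ \oo --> T ->
  (\sum_(1 <= k <oo) (cmod (a k) * r ^+ k)%:E = T%:E)%E.
Proof.
move=> cT; apply: nneseries_EFin; rewrite -cvg_shiftS.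
rewrite (_ : (fun n => _) = (fun n => \sum_(k < n) cmod (a k.+1) * r ^+ k.+1))//.
by apply/funext => n; rewrite big_add1 /= big_mkord.
Qed.

Lemma area_over_pi (R : realType) (f : R[i]^o -> R[i]^o) (a : nat -> R[i]) (r S : R) :
  power_series_on_disk f a -> (forall k, cmod (a k) <= 1) -> 0 <= r < 1 ->
  (fun n => \sum_(k < n) k.+1%:R * cmod (a k.+1) ^+ 2 * r ^+ (2 * k.+1)) @ \oo --> S ->
  (image_area f r * (pi^-1)%:E = S%:E)%E.
Proof.
move=> fa a1 r01 cS; have -> : image_area f r = (pi * S)%:E.
  apply: (cvg_unique _ (image_area_cvg fa a1 r01)) => //.
  by apply: cvg_EFin; [exact: nearW|exact: cvgMr].
by rewrite -EFinM mulrAC divff ?mul1r// gt_eqF// pi_gt0.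
Qed.

Lemma bohr_sum1E (R : realType) (c : R) (f : R[i]^o -> R[i]^o) (a : nat -> R[i]) (r S T : R) :
  power_series_on_disk f a -> (forall k, cmod (a k) <= 1) -> 0 <= r < 1 ->
  (fun n => \sum_(k < n) cmod (a k.+1) * r ^+ k.+1) @ \oo --> T ->
  (fun n => \sum_(k < n) k.+1%:R * cmod (a k.+1) ^+ 2 * r ^+ (2 * k.+1)) @ \oo --> S ->
  bohr_sum1 c f a r = (cmod (a 0%N) + T + c * S)%:E.
Proof.
move=> fa a1 r01 cT cS.
rewrite /bohr_sum1 (area_over_pi fa a1 r01 cS) -EFinM.
rewrite (@nneseries_EFin _ _ _ (cmod (a 0%N) + T)) -?EFinD//.
rewrite -cvg_shiftS.
rewrite (_ : (fun n => _) = (fun n => cmod (a 0%N) + \sum_(k < n) cmod (a k.+1) * r ^+ k.+1)).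
  by apply: cvgD => //; exact: cvg_cst.
by apply/funext => n; rewrite big_mkord big_ord_recl expr0 mulr1.
Qed.

Lemma bohr_sum2E (R : realType) (c : R) (f : R[i]^o -> R[i]^o) (a : nat -> R[i]) (r S T : R) :
  power_series_on_disk f a -> (forall k, cmod (a k) <= 1) -> 0 <= r < 1 ->
  (fun n => \sum_(k < n) cmod (a k.+1) * r ^+ k.+1) @ \oo --> T ->
  (fun n => \sum_(k < n) k.+1%:R * cmod (a k.+1) ^+ 2 * r ^+ (2 * k.+1)) @ \oo --> S ->
  bohr_sum2 c f a r = (cmod (a 0%N) ^+ 2 + T + c * S)%:E.
Proof.
move=> fa a1 r01 cT cS.
by rewrite /bohr_sum2 (area_over_pi fa a1 r01 cS) (bohr_tail cT) -EFinM -!EFinD.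
Qed.

Lemma bounded_ge0_series_cvg (R : realType) (x : nat -> R) (C : R) :
  (forall k, 0 <= x k) -> (forall n, \sum_(k < n) x k <= C) ->
  exists l : R, (fun n => \sum_(k < n) x k) @ \oo --> l.
Proof.
move=> x0 xC; suff /cvg_ex : cvgn (fun n => \sum_(k < n) x k) by [].
apply: nondecreasing_is_cvgn.
  apply/nondecreasing_seqP => n; by rewrite big_ord_recr lerDl.
by exists C => _ [n _ <-].
Qed.

(** Uniform bounds on partial sums make the series converge and pass to the limit;
    the number of terms of the two series varies independently, so that each is
    bounded on its own. *)
Lemma bohr_sums_cvg_le1 (R : realType) (a : nat -> R[i]) (r c b : R) :
  0 <= r -> 0 < c ->
  (forall m n, b + \sum_(k < m) cmod (a k.+1) * r ^+ k.+1
     + c * \sum_(k < n) k.+1%:R * cmod (a k.+1) ^+ 2 * r ^+ (2 * k.+1) <= 1) ->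
  exists T S : R, [/\ (fun n => \sum_(k < n) cmod (a k.+1) * r ^+ k.+1) @ \oo --> T,
    (fun n => \sum_(k < n) k.+1%:R * cmod (a k.+1) ^+ 2 * r ^+ (2 * k.+1)) @ \oo --> S
    & b + T + c * S <= 1].
Proof.
move=> r0 c0 H.
have [T cT] : exists T : R, (fun n => \sum_(k < n) cmod (a k.+1) * r ^+ k.+1) @ \oo --> T.
  apply: (@bounded_ge0_series_cvg _ (fun k => cmod (a k.+1) * r ^+ k.+1) (1 - b)) => [k|n].
    by rewrite mulr_ge0 ?cmod_ge0// exprn_ge0.
  by have := H n 0%N; rewrite big_ord0 mulr0 addr0 lerBrDl.
have [S cS] : exists S : R,
    (fun n => \sum_(k < n) k.+1%:R * cmod (a k.+1) ^+ 2 * r ^+ (2 * k.+1)) @ \oo --> S.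
  apply: (@bounded_ge0_series_cvg _
    (fun k => k.+1%:R * cmod (a k.+1) ^+ 2 * r ^+ (2 * k.+1)) ((1 - b) / c)) => [k|n].
    by apply: mulr_ge0; [apply: mulr_ge0; rewrite ?sqr_ge0|exact: exprn_ge0].
  by have := H 0%N n; rewrite big_ord0 addr0 ler_pdivlMr// mulrC lerBrDl.
exists T, S; split=> //.
have cB : (fun n => b + \sum_(k < n) cmod (a k.+1) * r ^+ k.+1
    + c * \sum_(k < n) k.+1%:R * cmod (a k.+1) ^+ 2 * r ^+ (2 * k.+1)) @ \oo --> b + T + c * S.
  by apply: cvgD; [apply: cvgD => //; exact: cvg_cst|exact: cvgMr].
rewrite -(cvg_lim (@Rhausdorff R) cB); apply: limr_le.
  by apply/cvg_ex; exists (b + T + c * S).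
by apply: nearW => n; exact: H.
Qed.

Lemma bohr_inequality1 (R : realType) : bohr_inequality (bohr_sum1 (16 / 9 : R)) (1 / 3).
Proof.
move=> f a fa fb r /andP[r0 r1] r3.
have [T [S [cT cS le1]]] := bohr_sums_cvg_le1 r0 (ltac:(lra) : 0 < 16 / 9 :> R)
  (fun m n => bohr_partial_sums1_le1 m n fa fb r0 r3).
rewrite (bohr_sum1E _ fa (fun k => cmod_coef_le1 k fa fb) _ cT cS) ?lee_fin//.
by rewrite r0.
Qed.

Lemma bohr_inequality2 (R : realType) : bohr_inequality (bohr_sum2 (9 / 8 : R)) (1 / 2).
Proof.
move=> f a fa fb r /andP[r0 r1] r3.
have [T [S [cT cS le1]]] := bohr_sums_cvg_le1 r0 (ltac:(lra) : 0 < 9 / 8 :> R)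
  (fun m n => bohr_partial_sums2_le1 m n fa fb r0 r3).
rewrite (bohr_sum2E _ fa (fun k => cmod_coef_le1 k fa fb) _ cT cS) ?lee_fin//.
by rewrite r0.
Qed.

(** * Disk automorphisms and sharpness *)

(** The automorphism of the disk exchanging 0 and alpha. *)
Definition mobius (R : realType) (alpha : R) : R[i]^o -> R[i]^o :=
  fun z => (alpha%:C - z) / (1 - alpha%:C * z).

Definition mobius_coef (R : realType) (alpha : R) (k : nat) : R[i] :=
  if k is j.+1 then (- ((1 - alpha ^+ 2) * alpha ^+ j))%:C else alpha%:C.

Lemma mobius_denom_neq0 (R : realType) (alpha : R) (z : R[i]) :
  0 < alpha < 1 -> cmod z < 1 -> 1 - alpha%:C * z != 0.
Proof.
move=> /andP[a0 a1] z1; rewrite subr_eq0 eq_sym; apply/eqP => h.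
have : cmod (alpha%:C * z) = 1 by rewrite h cmod1.
rewrite cmodM cmodR gtr0_norm//; have := cmod_ge0 z; nra.
Qed.

(** The difference of the squared moduli of denominator and numerator is
    (1 - alpha^2) (1 - |z|^2). *)
Lemma mobius_bounded (R : realType) (alpha : R) :
  0 < alpha < 1 -> bounded_by_one_on_disk (mobius alpha).
Proof.
move=> a01 z z1; have d := mobius_denom_neq0 a01 z1; have /andP[a0 a1] := a01.
rewrite /mobius cmodM cmodV ler_pdivrMr; last first.
  by rewrite lt_neqAle cmod_ge0 andbT eq_sym -(inj_eq (@complex.complexI R)) cmodE normr_eq0.
rewrite mul1r -(@ler_pXn2r _ 2) ?nnegrE ?cmod_ge0// !sqr_cmod.
have : cmod z ^+ 2 <= 1 by rewrite expr_le1 ?cmod_ge0 ?ltW.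
rewrite sqr_cmod; case: z {z1 d} => x y /= xy.
have : 0 <= (1 - alpha ^+ 2) * (1 - (x ^+ 2 + y ^+ 2)).
  by rewrite mulr_ge0 ?subr_ge0// expr_le1 ?ltW.
lra.
Qed.

Lemma mobius_power_series (R : realType) (alpha : R) :
  0 < alpha < 1 -> power_series_on_disk (mobius alpha) (mobius_coef alpha).
Proof.
move=> a01 z z1; have d := mobius_denom_neq0 a01 z1; have /andP[a0 a1] := a01.
rewrite -cvg_shiftS.
pose K := (1 - alpha ^+ 2)%:C * z / (1 - alpha%:C * z).
have E n : series (fun k => mobius_coef alpha k * z ^+ k : R[i]^o) n.+1 - mobius alpha z
    = K * (alpha%:C * z) ^+ n.
  rewrite seriesEord /= big_ord_recl /= expr0 mulr1.
  rewrite (eq_bigr (fun k : 'I_n => - (1 - alpha ^+ 2)%:C * z * (alpha%:C * z) ^+ k)); last first.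
    by move=> k _; rewrite /bump /= add1n rmorphN rmorphM rmorphXn /= exprMn [z ^+ k.+1]exprS; ring.
  rewrite -mulr_sumr; set G := \sum_(_ < _) _.
  have hG : G * (1 - alpha%:C * z) = 1 - (alpha%:C * z) ^+ n.
    by rewrite mulrC -opprB mulNr -subrX1 opprB.
  have -> : (alpha%:C * z) ^+ n = 1 - G * (1 - alpha%:C * z) by rewrite hG; ring.
  rewrite /K /mobius rmorphB rmorph1 rmorphXn /=; field; exact: d.
apply/cvg_cmodP => e e0.
have : (fun n => cmod K * alpha ^+ n) @ \oo --> cmod K * 0.
  by apply: cvgMr; apply: cvg_expr; rewrite ger0_norm// ltW.
rewrite mulr0 => /cvgrPdist_lt /(_ _ e0); apply: filterS => n.
rewrite sub0r normrN ger0_norm ?mulr_ge0 ?cmod_ge0 ?exprn_ge0 ?ltW// => h.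
rewrite E; apply: le_lt_trans h; rewrite cmodM ler_wpM2l ?cmod_ge0// cmodX.
have az : 0 <= alpha by exact: ltW.
rewrite lerXn2r ?nnegrE ?cmod_ge0// cmodM cmodR ger0_norm//.
by rewrite ler_piMr// ltW.
Qed.

Lemma cmod_mobius_coefS (R : realType) (alpha : R) k : 0 < alpha < 1 ->
  cmod (mobius_coef alpha k.+1) = (1 - alpha ^+ 2) * alpha ^+ k.
Proof.
move=> /andP[a0 a1]; rewrite /mobius_coef cmodR normrN ger0_norm// mulr_ge0//.
  by rewrite subr_ge0 expr_le1 ?ltW.
by rewrite exprn_ge0// ltW.
Qed.

Lemma cvg_geo_sum (R : realType) (q : R) : 0 <= q < 1 ->
  (fun n => \sum_(k < n) q ^+ k) @ \oo --> (1 - q)^-1.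
Proof.
move=> /andP[q0 q1].
have := @cvg_geometric_series R 1 q; rewrite ger0_norm// mul1r => /(_ q1).
rewrite (_ : series _ = (fun n => \sum_(k < n) q ^+ k))//.
by rewrite seriesEord; apply/funext => n; apply: eq_bigr => k _; rewrite /= mul1r.
Qed.

(** The limit L exists since the sums are monotone and bounded; shifting the index
    gives L = q L + (1 - q)^-1. *)
Lemma cvg_geo_deriv_sum (R : realType) (q : R) : 0 <= q < 1 ->
  (fun n => \sum_(k < n) k.+1%:R * q ^+ k) @ \oo --> (1 - q) ^- 2.
Proof.
move=> q01; have /andP[q0 q1] := q01.
have [L cL] := @bounded_ge0_series_cvg R (fun k => k.+1%:R * q ^+ k) _
  (fun k => mulr_ge0 (ler0n _ _) (exprn_ge0 _ q0)) (fun n => sum_geo_deriv_le n q01).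
have q1' : 1 - q != 0 by rewrite gt_eqF// subr_gt0.
suff <- : L = (1 - q) ^- 2 by [].
have rec n : \sum_(k < n.+1) k.+1%:R * q ^+ k
    = q * (\sum_(k < n) k.+1%:R * q ^+ k) + \sum_(k < n.+1) q ^+ k.
  elim: n => [|n IH]; first by rewrite !big_ord_recr !big_ord0 /= mulr0; ring.
  rewrite big_ord_recr /= {1}IH [\sum_(k < n.+2) _]big_ord_recr /=.
  move: (\sum_(k < n.+1) q ^+ k) IH => G IH.
  by rewrite [\sum_(k < n.+1) _]big_ord_recr /= exprS -!natr1; ring.
have c1 : (fun n => \sum_(k < n.+1) k.+1%:R * q ^+ k) @ \oo --> L.
  by rewrite (cvg_shiftS (fun n => \sum_(k < n) k.+1%:R * q ^+ k)).
have c2 : (fun n => \sum_(k < n.+1) k.+1%:R * q ^+ k) @ \oo --> q * L + (1 - q)^-1.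
  under eq_fun do rewrite rec.
  apply: cvgD; first exact: cvgMr.
  by rewrite (cvg_shiftS (fun n => \sum_(k < n) q ^+ k)); exact: cvg_geo_sum.
have e : L = q * L + (1 - q)^-1 by exact: (cvg_unique _ c1 c2).
have : (1 - q) * L = (1 - q)^-1 by rewrite mulrBl mul1r {1}e addrAC subrr add0r.
by move=> h; rewrite -[L](mulKf q1') h -expr2 exprVn.
Qed.

Lemma mobius_sums_cvg (R : realType) (alpha r : R) : 0 < alpha < 1 -> 0 <= r < 1 ->
  (fun n => \sum_(k < n) cmod (mobius_coef alpha k.+1) * r ^+ k.+1) @ \oo
    --> (1 - alpha ^+ 2) * r / (1 - alpha * r) /\
  (fun n => \sum_(k < n) k.+1%:R * cmod (mobius_coef alpha k.+1) ^+ 2 * r ^+ (2 * k.+1)) @ \oo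
    --> r ^+ 2 * (1 - alpha ^+ 2) ^+ 2 / (1 - alpha ^+ 2 * r ^+ 2) ^+ 2.
Proof.
move=> a01 /andP[r0 r1]; have /andP[a0 a1] := a01.
have q1 : 0 <= alpha * r < 1 by apply/andP; split; nra.
have q2 : 0 <= alpha ^+ 2 * r ^+ 2 < 1.
  by rewrite -exprMn sqr_ge0 expr_lt1//; case/andP: q1.
split.
  rewrite (_ : (fun n => _) = (fun n => (1 - alpha ^+ 2) * r * \sum_(k < n) (alpha * r) ^+ k)).
    by apply: cvgMr; exact: cvg_geo_sum.
  apply/funext => n; rewrite mulr_sumr; apply: eq_bigr => k _.
  by rewrite cmod_mobius_coefS// exprMn [r ^+ k.+1]exprS; ring.
rewrite (_ : (fun n => _) = (fun n => r ^+ 2 * (1 - alpha ^+ 2) ^+ 2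
    * \sum_(k < n) k.+1%:R * (alpha ^+ 2 * r ^+ 2) ^+ k)).
  by apply: cvgMr; exact: cvg_geo_deriv_sum.
apply/funext => n; rewrite mulr_sumr; apply: eq_bigr => k _.
rewrite cmod_mobius_coefS// mulnS exprD exprM [((1 - _) * _) ^+ 2]exprMn.
by rewrite [(alpha ^+ k) ^+ 2]exprAC [(alpha ^+ 2 * _) ^+ k]exprMn; ring.
Qed.

Lemma mobius_bohr (R : realType) (alpha r c : R) : 0 < alpha < 1 -> 0 <= r < 1 ->
  bohr_sum1 c (mobius alpha) (mobius_coef alpha) r
  = (alpha + (1 - alpha ^+ 2) * r / (1 - alpha * r)
     + c * (r ^+ 2 * (1 - alpha ^+ 2) ^+ 2 / (1 - alpha ^+ 2 * r ^+ 2) ^+ 2))%:E /\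
  bohr_sum2 c (mobius alpha) (mobius_coef alpha) r
  = (alpha ^+ 2 + (1 - alpha ^+ 2) * r / (1 - alpha * r)
     + c * (r ^+ 2 * (1 - alpha ^+ 2) ^+ 2 / (1 - alpha ^+ 2 * r ^+ 2) ^+ 2))%:E.
Proof.
move=> a01 r01; have [cT cS] := mobius_sums_cvg a01 r01.
have fa := mobius_power_series a01; have fb := mobius_bounded a01.
have a1 k := cmod_coef_le1 k fa fb.
have a0E : cmod (mobius_coef alpha 0%N) = alpha.
  by rewrite /= cmodR ger0_norm//; case/andP: a01 => /ltW.
by rewrite (bohr_sum1E c fa a1 r01 cT cS) (bohr_sum2E c fa a1 r01 cT cS) a0E.
Qed.

(** Without the area term, the sum for the automorphism exceeds 1 as soon as
    r (1 + 2 alpha) > 1; the alpha chosen lies halfway between this threshold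
    and 1. *)
Lemma bohr1_radius_sharp (R : realType) (c rho : R) : 0 <= c -> 1 / 3 < rho ->
  ~ bohr_inequality (bohr_sum1 c) rho.
Proof.
(* rho may exceed 1; any bound between 1/3 and 1 works here. *)
move=> c0 hrho H; pose r := Num.min rho (1 / 2).
have r3 : 1 / 3 < r by rewrite lt_min hrho; lra.
have r2 : r <= 1 / 2 by rewrite ge_min lexx orbT.
have rr : r <= rho by rewrite ge_min lexx.
pose alpha := (r^-1 + 1) / 4.
have ra : r * alpha = (1 + r) / 4 by rewrite /alpha; field; rewrite gt_eqF//; lra.
have a01 : 0 < alpha < 1 by apply/andP; split; nra.
have r01 : 0 <= r < 1 by apply/andP; split; lra.
have := H _ _ (mobius_power_series a01) (mobius_bounded a01) r r01 rr.
rewrite (mobius_bohr c a01 r01).1 lee_fin; apply/negP; rewrite -ltNge.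
have /andP[a0 a1] := a01.
have area0 : 0 <= c * (r ^+ 2 * (1 - alpha ^+ 2) ^+ 2 / (1 - alpha ^+ 2 * r ^+ 2) ^+ 2).
  by rewrite mulr_ge0// divr_ge0 ?sqr_ge0// mulr_ge0 ?sqr_ge0.
apply: lt_le_trans (_ : _ < alpha + (1 - alpha ^+ 2) * r / (1 - alpha * r)) _; last first.
  by rewrite lerDl.
rewrite -ltrBlDl ltr_pdivlMr; last by nra.
nra.
Qed.

(** Here the condition is r (1 + alpha) > 1, and alpha is again halfway between the
    threshold and 1. *)
Lemma bohr2_radius_sharp (R : realType) (c rho : R) : 0 <= c -> 1 / 2 < rho ->
  ~ bohr_inequality (bohr_sum2 c) rho.
Proof.
(* rho may exceed 1; any bound between 1/2 and 1 works here. *)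
move=> c0 hrho H; pose r := Num.min rho (2 / 3).
have r3 : 1 / 2 < r by rewrite lt_min hrho; lra.
have r2 : r <= 2 / 3 by rewrite ge_min lexx orbT.
have rr : r <= rho by rewrite ge_min lexx.
pose alpha := (2 * r)^-1.
have ra : r * alpha = 1 / 2 by rewrite /alpha; field; rewrite gt_eqF//; lra.
have a01 : 0 < alpha < 1 by apply/andP; split; nra.
have r01 : 0 <= r < 1 by apply/andP; split; lra.
have := H _ _ (mobius_power_series a01) (mobius_bounded a01) r r01 rr.
rewrite (mobius_bohr c a01 r01).2 lee_fin; apply/negP; rewrite -ltNge.
have /andP[a0 a1] := a01.
have area0 : 0 <= c * (r ^+ 2 * (1 - alpha ^+ 2) ^+ 2 / (1 - alpha ^+ 2 * r ^+ 2) ^+ 2).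
  by rewrite mulr_ge0// divr_ge0 ?sqr_ge0// mulr_ge0 ?sqr_ge0.
apply: lt_le_trans (_ : _ < alpha ^+ 2 + (1 - alpha ^+ 2) * r / (1 - alpha * r)) _; last first.
  by rewrite lerDl.
rewrite -ltrBlDl ltr_pdivlMr; last by nra.
nra.
Qed.

(** At r = 1/3 the sum exceeds 1 if and only if
    9 c (1 + alpha)^2 > 2 (3 - alpha) (3 + alpha)^2.  The right side is at most
    64, its value at alpha = 1, and the left side is at least 36 c alpha. *)
Lemma bohr1_constant_sharp (R : realType) (c : R) : 16 / 9 < c ->
  ~ bohr_inequality (bohr_sum1 c) (1 / 3).
Proof.
move=> c16 H.
pose alpha := (1 + 16 / (9 * c)) / 2.
have ca : c * alpha = (c + 16 / 9) / 2 by rewrite /alpha; field; rewrite gt_eqF//; lra.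
have a01 : 0 < alpha < 1 by apply/andP; split; nra.
have r01 : 0 <= (1 / 3 : R) < 1 by apply/andP; split; lra.
have := H _ _ (mobius_power_series a01) (mobius_bounded a01) (1 / 3) r01 (lexx _).
rewrite (mobius_bohr c a01 r01).1 lee_fin; apply/negP; rewrite -ltNge -subr_gt0.
have /andP[a0 a1] := a01.
have d3 : 3 - alpha != 0 by rewrite gt_eqF//; lra.
have d9 : 9 - alpha ^+ 2 != 0 by rewrite gt_eqF//; nra.
rewrite (_ : _ - 1 = (1 - alpha) ^+ 2 *
  (9 * c * (1 + alpha) ^+ 2 - 2 * (3 - alpha) * (3 + alpha) ^+ 2) / (9 - alpha ^+ 2) ^+ 2).
  rewrite divr_gt0 ?exprn_even_gt0// mulr_gt0 ?exprn_gt0 ?subr_gt0//.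
  have h1 : 2 * (3 - alpha) * (3 + alpha) ^+ 2 <= 64.
    have : 0 <= (1 - alpha) ^+ 2 * (5 + alpha) by rewrite mulr_ge0 ?sqr_ge0//; lra.
    lra.
  have : 0 <= 9 * c * (1 - alpha) ^+ 2 by rewrite mulr_ge0 ?sqr_ge0//; lra.
  lra.
by field; rewrite d3 d9.
Qed.

(** With alpha = 1 - delta, the sum at r = 1/2 exceeds 1 if and only if
    4 c (2 - delta) > (1 + delta) (3 - delta)^2.  The right side is at most
    9 + 3 delta, so any delta in (0, 1) below (8 c - 9) / (4 c + 3)
    will do; half of this bound is less than 1. *)
Lemma bohr2_constant_sharp (R : realType) (c : R) : 9 / 8 < c ->
  ~ bohr_inequality (bohr_sum2 c) (1 / 2).
Proof.
move=> c9 H.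
pose delta := (8 * c - 9) / (2 * (4 * c + 3)); pose alpha := 1 - delta.
have cd : 2 * delta * (4 * c + 3) = 8 * c - 9.
  by rewrite /delta; field; rewrite gt_eqF//; lra.
have d01 : 0 < delta < 1.
  by rewrite /delta divr_gt0 ?ltr_pdivrMr//=; lra.
have /andP[d0 d1] := d01.
have a01 : 0 < alpha < 1 by rewrite /alpha; apply/andP; split; lra.
have r01 : 0 <= (1 / 2 : R) < 1 by apply/andP; split; lra.
have := H _ _ (mobius_power_series a01) (mobius_bounded a01) (1 / 2) r01 (lexx _).
rewrite (mobius_bohr c a01 r01).2 lee_fin; apply/negP; rewrite -ltNge -subr_gt0.
have /andP[a0 a1] := a01.
have d2 : 2 - alpha != 0 by rewrite gt_eqF//; lra.
have d4 : 4 - alpha ^+ 2 != 0 by rewrite gt_eqF//; nra.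
rewrite (_ : _ - 1 = (1 - alpha) ^+ 2 * (1 + alpha) *
  (4 * c * (1 + alpha) - (2 - alpha) * (2 + alpha) ^+ 2) / (4 - alpha ^+ 2) ^+ 2).
  rewrite divr_gt0 ?exprn_even_gt0// !mulr_gt0 ?exprn_gt0 ?subr_gt0//; first by lra.
  rewrite /alpha; nra.
by field; rewrite d2 d4.
Qed.

Theorem theorem3 (R : realType) :
  [/\ bohr_inequality (bohr_sum1 (16 / 9 : R)) (1 / 3),
      (forall rho : R, 1 / 3 < rho ->
         ~ bohr_inequality (bohr_sum1 (16 / 9)) rho)
    & (forall c : R, 16 / 9 < c ->
         ~ bohr_inequality (bohr_sum1 c) (1 / 3))] /\
  [/\ bohr_inequality (bohr_sum2 (9 / 8 : R)) (1 / 2),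
      (forall rho : R, 1 / 2 < rho ->
         ~ bohr_inequality (bohr_sum2 (9 / 8)) rho)
    & (forall c : R, 9 / 8 < c ->
         ~ bohr_inequality (bohr_sum2 c) (1 / 2))].
Proof.
split; split.
- exact: bohr_inequality1.
- by move=> rho; apply: bohr1_radius_sharp; lra.
- exact: bohr1_constant_sharp.
- exact: bohr_inequality2.
- by move=> rho; apply: bohr2_radius_sharp; lra.
- exact: bohr2_constant_sharp.
Qed.
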